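(* Let $d$ be a graphic list. The following are equivalent, and each is equivalent to $d$ being decisive: (1) No realization of $d$ contains a $(3,3)$-blossom. (2) Every realization of $d$ is $\mathcal{B}$-free. (3) $d$ has a $\mathcal{B}$-free realization. (4) $d$ has a realization $G$ for which there is a partition $V_1,V_2,V_3$ of $V(G)$ such that (i) $V_1$ is an independent set and $V_2$ is a clique; (ii) each vertex of $V_3$ is adjacent to every vertex of $V_2$ and to no vertex of $V_1$; and (iii) $G[V_3]$ is split, or has fewer than six vertices, or is isomorphic to one of $U$, $\overline{U}$, $K_2+K_{1,m}$, or $(K_m+K_1)\vee 2K_1$ for some integer $m\ge3$. (5) Every realization of $d$ has a partition $V_1,V_2,V_3$ of its vertex set as described in (4).
   Context: A realization of a graphic list $d=(d_1,\dots,d_n)$ is a simple graph on $[n]$ in which vertex $i$ has degree $d_i$. The list $d$ is decisive if every vertex of the polytope $P(d)=\{x\in\mathbb{R}^{\binom n2}: \sum_{i\ne j}x_{ij}=d_j \ \forall j,\ 0\le x_{ij}\le1\ \forall i<j\}$ (coordinates indexed by unordered pairs of distinct elements of $[n]$) has all coordinates in $\{0,1\}$. A $(3,3)$-blossom in a simple graph $G$ is a set of six distinct vertices $v_1,v_2,v_3,w_1,w_2,w_3$ such that in the sequence of pairs $v_1v_2, v_2v_3, v_3v_1, v_1w_1, w_1w_2, w_2w_3, w_3w_1$ consecutive pairs alternate between non-edges and edges of $G$ ($v_1w_1$ may be either); other pairs are unrestricted. $\mathcal{B}$ is the set of all (six-vertex) graphs whose degree sequence is one of $(1,1,1,1,1,1)$,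 $(2,2,1,1,1,1)$, $(2,2,2,2,1,1)$, $(2,2,2,2,2,2)$, $(3,2,2,1,1,1)$, $(3,2,2,2,2,1)$, $(3,3,2,2,1,1)$, $(3,3,2,2,2,2)$, $(3,3,3,2,2,1)$, $(3,3,3,3,1,1)$, $(3,3,3,3,2,2)$, $(3,3,3,3,3,3)$, $(4,2,2,2,1,1)$, $(4,3,2,2,2,1)$, $(4,3,3,2,2,2)$, $(4,3,3,3,2,1)$, $(4,3,3,3,3,2)$, $(4,4,2,2,2,2)$, $(4,4,3,3,2,2)$, $(4,4,3,3,3,1)$, $(4,4,3,3,3,3)$, $(4,4,4,3,3,2)$, $(4,4,4,4,3,3)$, $(4,4,4,4,4,4)$. A graph is $\mathcal{B}$-free if it has no induced subgraph isomorphic to a member of $\mathcal{B}$. A graph is split if its vertex set can be partitioned into an independent set and a clique. $U$ is the unique graph with degree sequence $(4,2,2,2,2,2)$ (a triangle and a 4-cycle sharing exactly one vertex), and $\overline{U}$ is its complement. $+$ denotes disjoint union, $\vee$ denotes join, $K_m$ is the complete graph, $K_{1,m}$ the star, and $2K_1$ two nonadjacent vertices. *)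

(* Defs.v *)
From mathcomp Require Import all_boot all_order all_algebra.
From mathcomp Require Import classical_sets reals.

Set Implicit Arguments.
Unset Strict Implicit.
Unset Printing Implicit Defensive.

Import Order.TTheory GRing.Theory Num.Theory.

Record sgraph (T : finType) := SGraph {
  edge :> rel T;
  edge_sym : symmetric edge;
  edge_irr : irreflexive edge
}.

Definition degree (T : finType) (G : sgraph T) (v : T) : nat :=
  #|[set w | G v w]|.

Definition graph_iso (T T' : finType) (G : sgraph T) (H : sgraph T') : Prop :=
  exists2 f : T -> T', bijective f & forall x y, H (f x) (f y) = G x y.

Definition induced_rel (T : finType) (G : sgraph T) (A : {set T}) :
  rel {x | x \in A} := [rel x y | G (val x) (val y)].

Lemma induced_sym (T : finType) (G : sgraph T) A :
  symmetric (@induced_rel T G A).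
Proof. by move=> x y; apply: edge_sym. Qed.

Lemma induced_irr (T : finType) (G : sgraph T) A :
  irreflexive (@induced_rel T G A).
Proof. by move=> x; apply: edge_irr. Qed.

Definition induced (T : finType) (G : sgraph T) (A : {set T}) :
  sgraph {x | x \in A} := SGraph (@induced_sym T G A) (@induced_irr T G A).

Definition independent (T : finType) (G : sgraph T) (A : {set T}) : Prop :=
  {in A &, forall x y, ~~ G x y}.

Definition clique (T : finType) (G : sgraph T) (A : {set T}) : Prop :=
  {in A &, forall x y, x != y -> G x y}.

Definition split_graph (T : finType) (G : sgraph T) : Prop :=
  exists A : {set T}, independent G A /\ clique G (~: A).

Definition compl_rel (T : finType) (G : sgraph T) : rel T :=
  [rel x y | (x != y) && ~~ G x y].

Lemma compl_sym (T : finType) (G : sgraph T) : symmetric (compl_rel G).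
Proof. by move=> x y; rewrite /compl_rel /= eq_sym edge_sym. Qed.

Lemma compl_irr (T : finType) (G : sgraph T) : irreflexive (compl_rel G).
Proof. by move=> x; rewrite /compl_rel /= eqxx. Qed.

Definition compl (T : finType) (G : sgraph T) : sgraph T :=
  SGraph (compl_sym G) (compl_irr G).

Definition sum_rel (cross : bool) (T T' : finType)
    (G : sgraph T) (H : sgraph T') : rel (T + T')%type :=
  fun u v => match u, v with
  | inl x, inl y => G x y
  | inr x, inr y => H x y
  | _, _ => cross
  end.

Lemma sum_sym cross (T T' : finType) (G : sgraph T) (H : sgraph T') :
  symmetric (sum_rel cross G H).
Proof. by move=> [x|x] [y|y] //=; apply: edge_sym. Qed.

Lemma sum_irr cross (T T' : finType) (G : sgraph T) (H : sgraph T') :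
  irreflexive (sum_rel cross G H).
Proof. by move=> [x|x] /=; apply: edge_irr. Qed.

Definition disjoint_union (T T' : finType) (G : sgraph T) (H : sgraph T') :
  sgraph (T + T')%type := SGraph (sum_sym false G H) (sum_irr false G H).

Definition join (T T' : finType) (G : sgraph T) (H : sgraph T') :
  sgraph (T + T')%type := SGraph (sum_sym true G H) (sum_irr true G H).

Definition complete_rel (m : nat) : rel 'I_m := [rel x y | x != y].

Lemma complete_sym m : symmetric (@complete_rel m).
Proof. by move=> x y; rewrite /complete_rel /= eq_sym. Qed.

Lemma complete_irr m : irreflexive (@complete_rel m).
Proof. by move=> x; rewrite /complete_rel /= eqxx. Qed.

Definition complete (m : nat) : sgraph 'I_m :=
  SGraph (@complete_sym m) (@complete_irr m).

Definition star_rel (m : nat) : rel 'I_m.+1 :=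
  [rel x y | (x == ord0) != (y == ord0)].

Lemma star_sym m : symmetric (@star_rel m).
Proof. by move=> x y; rewrite /star_rel /= eq_sym. Qed.

Lemma star_irr m : irreflexive (@star_rel m).
Proof. by move=> x; rewrite /star_rel /= eqxx. Qed.

Definition star (m : nat) : sgraph 'I_m.+1 :=
  SGraph (@star_sym m) (@star_irr m).

(* The triangle 0 1 2 and the 4-cycle 0 3 4 5, sharing the vertex 0. *)
Definition U_edges : seq (nat * nat) :=
  [:: (0, 1); (1, 2); (2, 0); (0, 3); (3, 4); (4, 5); (5, 0)].

Definition U_rel : rel 'I_6 := [rel x y |
  ((val x, val y) \in U_edges) || ((val y, val x) \in U_edges)].

Lemma U_sym : symmetric U_rel.
Proof. by move=> x y; rewrite /U_rel /= orbC. Qed.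

Lemma U_irr : irreflexive U_rel.
Proof. by case; do 6?[case=> //]. Qed.

Definition U_graph : sgraph 'I_6 := SGraph U_sym U_irr.

Definition realization (n : nat) (d : n.-tuple nat) (G : sgraph 'I_n) : Prop :=
  forall i, degree G i = tnth d i.

Definition graphic (n : nat) (d : n.-tuple nat) : Prop :=
  exists G : sgraph 'I_n, realization d G.

Notation vpair n := {e : {set 'I_n} | #|e| == 2}.

Section Polytope.
Local Open Scope ring_scope.
Local Open Scope classical_set_scope.

(* [R^o] is [R] viewed as a module over itself, which makes the functions
   a vector space over [R]. *)
Definition polytope (R : realType) (n : nat) (d : n.-tuple nat) :
  set {ffun vpair n -> R^o} :=
  [set x | (forall j : 'I_n,
              \sum_(e : vpair n | j \in val e) x e = (tnth d j)%:R)
         /\ (forall e, 0 <= x e <= 1)].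

(* The vertices of a polytope are its extreme points. *)
Definition extreme_point (R : realType) (E : lmodType R) (P : set E) (x : E) :
  Prop :=
  P x /\ forall (y z : E) (t : R), P y -> P z -> 0 < t < 1 ->
    x = t *: y + (1 - t) *: z -> y = x /\ z = x.

Definition decisive (R : realType) (n : nat) (d : n.-tuple nat) : Prop :=
  forall x, extreme_point (@polytope R n d) x ->
    forall e, x e = 0 \/ x e = 1.

End Polytope.

(* The seven pairs strictly alternate.  The sequence may start with a non-edge,
   and then v1 w1 is an edge, or with an edge, and then v1 w1 is a non-edge. *)
Definition blossom33 (T : finType) (G : sgraph T) (v1 v2 v3 w1 w2 w3 : T) :
  Prop :=
  uniq [:: v1; v2; v3; w1; w2; w3] /\
  [/\ G v1 v2 != G v2 v3, G v2 v3 != G v3 v1, G v3 v1 != G v1 w1 &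
   [/\ G v1 w1 != G w1 w2, G w1 w2 != G w2 w3 & G w2 w3 != G w3 w1]].

Definition has_blossom33 (T : finType) (G : sgraph T) : Prop :=
  exists v1 v2 v3 w1 w2 w3, blossom33 G v1 v2 v3 w1 w2 w3.

Definition calB_degrees : seq (seq nat) :=
  [:: [:: 1; 1; 1; 1; 1; 1]; [:: 2; 2; 1; 1; 1; 1]; [:: 2; 2; 2; 2; 1; 1];
      [:: 2; 2; 2; 2; 2; 2]; [:: 3; 2; 2; 1; 1; 1]; [:: 3; 2; 2; 2; 2; 1];
      [:: 3; 3; 2; 2; 1; 1]; [:: 3; 3; 2; 2; 2; 2]; [:: 3; 3; 3; 2; 2; 1];
      [:: 3; 3; 3; 3; 1; 1]; [:: 3; 3; 3; 3; 2; 2]; [:: 3; 3; 3; 3; 3; 3];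
      [:: 4; 2; 2; 2; 1; 1]; [:: 4; 3; 2; 2; 2; 1]; [:: 4; 3; 3; 2; 2; 2];
      [:: 4; 3; 3; 3; 2; 1]; [:: 4; 3; 3; 3; 3; 2]; [:: 4; 4; 2; 2; 2; 2];
      [:: 4; 4; 3; 3; 2; 2]; [:: 4; 4; 3; 3; 3; 1]; [:: 4; 4; 3; 3; 3; 3];
      [:: 4; 4; 4; 3; 3; 2]; [:: 4; 4; 4; 4; 3; 3]; [:: 4; 4; 4; 4; 4; 4]].

Definition calB (H : sgraph 'I_6) : bool :=
  sort geq [seq degree H v | v : 'I_6] \in calB_degrees.

Definition calB_free (T : finType) (G : sgraph T) : Prop :=
  forall (A : {set T}) (H : sgraph 'I_6), calB H -> ~ graph_iso (induced G A) H.

Definition core_graph (T : finType) (G : sgraph T) : Prop :=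
  [\/ split_graph G, #|T| < 6, graph_iso G U_graph |
   [\/ graph_iso G (compl U_graph),
       exists2 m, 3 <= m & graph_iso G (disjoint_union (complete 2) (star m)) |
       exists2 m, 3 <= m &
         graph_iso G (join (disjoint_union (complete m) (complete 1))
                           (disjoint_union (complete 1) (complete 1)))]].

(* The parts may be empty, as they must be when G itself is, say, a 5-cycle. *)
Definition has_core_partition (T : finType) (G : sgraph T) : Prop :=
  exists V1 V2 V3 : {set T},
    [/\ V1 :|: V2 :|: V3 = [set: T],
        [/\ [disjoint V1 & V2], [disjoint V1 & V3] & [disjoint V2 & V3]],
        independent G V1 /\ clique G V2,
        {in V3, forall x, {in V2, forall y, G x y} /\
                          {in V1, forall y, ~~ G x y}} &
        core_graph (induced G V3)].

(* Main.v *)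
Require Import Defs.
From mathcomp Require Import all_boot all_order all_algebra perm.
From mathcomp Require Import reals.
From mathcomp Require Import zify ring lra.

Set Implicit Arguments.
Unset Strict Implicit.
Unset Printing Implicit Defensive.

(* Putting weight 1/2 on the two triangles of a (3,3)-blossom and flipping
   [v1 w1] gives an extreme point of the polytope, since an odd cycle carries no
   nonzero edge weighting with zero sum at every vertex.  Each degree
   sequence of [calB] is that of a six-vertex graph with a (3,3)-blossom, so an
   induced member of [calB] can be exchanged for a blossom without changing
   degrees.  A [calB]-free graph that is not split contains 2K2, C4 or C5; the
   vertices that see none, all, or some of this subgraph form [V1], [V2] and
   [V3], and adjacencies are read off from graphs on at most seven vertices.
   Conversely, in a fractional extreme point the fractional pairs form a
   2-regular graph [F] whose vertex-edge incidence matrix is invertible, i.e. a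
   disjoint union of odd cycles, of weight 1/2.  Weighting [V2] by 1, [V1] by -1
   and [V3] by 0 confines [F] to [V3]; since [F] touches an even number of
   vertices, at least 6 of them, the degrees inside [V3] rule it out.  Every
   argument uses only one realization with a core partition, so (4) gives back
   decisiveness, hence (1), (2) and (5). *)

(** * Embeddings and small graphs *)

(** Complementation halves the case analysis: [calB], the core graphs and the fractional structure
    (under the map from x to 1 - x) are all stable under it. So C4, the complement of [U] and the
    join (K_m + K_1) with 2K_1 are reduced to 2K2, [U] and K_2 + K_{1,m}. On the polytope side the
    odd cycles enter through a single linear property: an integer potential s with s i + s j = 0 on
    every pair of [F] vanishes on the touched vertices. A contradiction is then reached by
    exhibiting a potential with values 1 and -1, which is the 2-colouring of an even cycle or comes
    from a split partition. Potentials have a second role. Twice the extreme point and twice the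
    adjacency matrix have the same row sums, so their difference is orthogonal to every matrix of
    the form s i + s j. When the sign of s i + s j dictates adjacency, all terms of that vanishing
    sum have one sign, and the two must agree wherever s i + s j is nonzero. *)

(** An isomorphism onto the induced subgraph, with no subtype and for bare relations, so that graphs
    can be replaced by complements or by pointwise equal relations. *)
Definition embeds_onto (T T' : finType) (G : rel T) (A : {set T})
    (H : rel T') : Prop :=
  exists f : T' -> T,
    [/\ injective f, f @: setT = A & forall x y, G (f x) (f y) = H x y].

Lemma induced_embeds (T T' : finType) (G : sgraph T) (A : {set T})
    (H : sgraph T') :
  graph_iso (induced G A) H <-> embeds_onto G A H.
Proof.
split.
  case=> h [k hK kK] hH; exists (fun y => val (k y)); split.
  - by move=> x y /val_inj/(can_inj kK).
  - apply/setP=> x; apply/imsetP/idP => [[y _ ->]|xA]; first exact: valP.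
    by exists (h (exist _ x xA)); rewrite //= hK.
  - by move=> x y; rewrite -[in RHS](kK x) -[in RHS](kK y) hH.
case=> f [f_inj fA fH].
have fP y : f y \in A by rewrite -fA imset_f.
pose k y : {x | x \in A} := exist _ (f y) (fP y).
have k_inj : injective k by move=> x y [/f_inj].
have cardT : #|T'| = #|{: {x | x \in A}}|.
  by rewrite card_sig -cardsT -(card_imset _ f_inj) fA; apply: eq_card.
have [h hK kK] := inj_card_bij k_inj (eq_leq (esym cardT)).
exists h; first by exists k.
by move=> x y; rewrite -fH -[in RHS](kK x) -[in RHS](kK y).
Qed.

Lemma calB_free_seq (T : finType) (G : sgraph T) (s : seq T) :
  calB_free G -> uniq s -> size s = 6 ->
  sort geq [seq count (G x) s | x <- s] \notin calB_degrees.
Proof.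
move=> Gfree s_uniq /eqP s_size; pose t : 6.-tuple T := Tuple s_size.
have tsym : symmetric (relpre (tnth t) G) by move=> x y; apply: edge_sym.
have tirr : irreflexive (relpre (tnth t) G) by move=> x; apply: edge_irr.
pose H := SGraph tsym tirr; apply/negP=> sB.
apply: (Gfree [set x in s] H).
  rewrite /calB; suff -> : [seq degree H v | v : 'I_6] =
    [seq count (G x) s | x <- s] by [].
  rewrite -[s]/(tval t) -[X in map _ X](map_tnth_enum t) -map_comp.
  rewrite /image_mem; apply: eq_map => v /=.
  rewrite -[X in count _ X](map_tnth_enum t) count_map /degree cardsE cardE.
  by rewrite enumT size_filter; apply: eq_count => w.
apply/induced_embeds; exists (tnth t); split=> //.
  by apply/tuple_uniqP.
apply/setP=> x; rewrite inE; apply/imsetP/idP => [[i _ ->]|/(@tnthP _ _ t)[i ->]].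
  exact: (mem_tnth i t).
by exists i.
Qed.

(* Small graphs on [0, .., k-1] are encoded by the lower triangle of their
   adjacency matrix, given row by row. *)
Definition adj (l : seq bitseq) (i j : nat) : bool :=
  nth false (nth [::] l i) j || nth false (nth [::] l j) i.

Definition rows (e : nat -> nat -> bool) (k : nat) : seq bitseq :=
  mkseq (fun j => mkseq (e j) j) k.

Lemma adj_rows (e : nat -> nat -> bool) k i j :
  symmetric e -> irreflexive e -> i < k -> j < k -> adj (rows e k) i j = e i j.
Proof.
move=> e_sym e_irr ik jk; rewrite /adj !(nth_mkseq [::]) //.
have [ij|ji|<-] := ltngtP i j.
- by rewrite nth_default ?size_mkseq 1?ltnW //= nth_mkseq // e_sym.
- by rewrite nth_mkseq // orbC nth_default ?size_mkseq 1?ltnW.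
- by rewrite nth_default ?size_mkseq // e_irr.
Qed.

Fixpoint bitseqs (k : nat) : seq bitseq :=
  if k is k'.+1 then
    [seq true :: l | l <- bitseqs k'] ++ [seq false :: l | l <- bitseqs k']
  else [:: [::]].

Lemma mem_bitseqs (l : bitseq) k : size l = k -> l \in bitseqs k.
Proof.
elim: l k => [|b l IHl] [|k] //= [/IHl lk].
by rewrite mem_cat; case: b; rewrite map_f ?orbT.
Qed.

Definition in_calB (e : nat -> nat -> bool) (vs : seq nat) : bool :=
  sort geq [seq count (e i) vs | i <- vs] \in calB_degrees.

Definition seq_rows (T : finType) (G : rel T) (s : seq T) : seq bitseq :=
  if s is x0 :: _ then rows (fun i j => G (nth x0 s i) (nth x0 s j)) (size s)
  else [::].

Lemma adj_seq_rows (T : finType) (G : sgraph T) (s : seq T) x0 i j :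
  i < size s -> j < size s ->
  adj (seq_rows G s) i j = G (nth x0 s i) (nth x0 s j).
Proof.
case: s => [|x s] // si sj; rewrite /seq_rows adj_rows //.
- by rewrite !(set_nth_default x0).
- by move=> u v; apply: edge_sym.
- by move=> u; apply: edge_irr.
Qed.

(** The list [vs] selects six positions of a possibly longer list, which lets seven-vertex
    configurations be tested through their six-vertex subsets. *)
Lemma calB_free_rows (T : finType) (G : sgraph T) (s : seq T) (vs : seq nat) :
  calB_free G -> uniq s -> uniq vs -> size vs = 6 -> all (gtn (size s)) vs ->
  ~~ in_calB (adj (seq_rows G s)) vs.
Proof.
move=> Gfree s_uniq vs_uniq vs_size /allP vs_lt.
case: s s_uniq vs_lt => [|x0 s'] s_uniq vs_lt.
  by case: vs vs_size vs_lt {vs_uniq} => // i vs _ /(_ i (mem_head _ _)).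
set s := x0 :: s' in s_uniq vs_lt *.
have := @calB_free_seq _ G [seq nth x0 s i | i <- vs] Gfree.
rewrite size_map vs_size => /(_ _ erefl).
rewrite map_inj_in_uniq => [/(_ vs_uniq)|i j /vs_lt si /vs_lt sj /eqP]; last first.
  by rewrite nth_uniq // => /eqP.
apply: contra; rewrite /in_calB -map_comp.
suff /eq_in_map -> : {in vs, (fun i => count (adj (seq_rows G s) i) vs) =1
    (fun x => count (G x) [seq nth x0 s i | i <- vs]) \o nth x0 s} by [].
move=> i /vs_lt si /=; rewrite count_map; apply: eq_in_count => j /vs_lt sj /=.
exact: (@adj_seq_rows _ G s x0 i j).
Qed.

Lemma complE (T : finType) (G : sgraph T) x y :
  compl G x y = (x != y) && ~~ G x y.
Proof. by []. Qed.

(** * Structure of calB-free graphs *)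

Definition two_K2 (T : finType) (G : rel T) (a b c d : T) : bool :=
  [&& G a b, G c d, ~~ G a c, ~~ G a d, ~~ G b c & ~~ G b d].

Definition ind_C5 (T : finType) (G : rel T) (a b c d e : T) : bool :=
  [&& G a b, G b c, G c d, G d e & G e a] &&
  [&& ~~ G a c, ~~ G a d, ~~ G b d, ~~ G b e & ~~ G c e].

(* Földes-Hammer: a clique maximising the total weight #|T| + degree of its
   vertices has an independent complement, since exchanging one or two vertices
   cannot increase its weight. *)
Lemma split_of_obstruction_free (T : finType) (G : sgraph T) :
  (forall a b c d, ~~ two_K2 G a b c d) ->
  (forall a b c d, ~~ two_K2 (compl G) a b c d) ->
  (forall a b c d e, ~~ ind_C5 G a b c d e) -> split_graph G.
Proof.
move=> no2K2 noC4 noC5; have Gsym := edge_sym G; have Girr := edge_irr G.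
have eqF x y : G x y -> (x == y) = false.
  by case: eqP => // ->; rewrite Girr.
have C4F x y z t : x != z -> y != t -> G x y -> G y z -> G z t -> G t x ->
    G x z = false -> G y t = false -> False.
  move=> xz yt xy yz zt tx nxz nyt; have := noC4 x z y t; rewrite /two_K2 !complE.
  by rewrite xz yt nxz nyt xy (Gsym z y) yz (Gsym x t) tx zt !andbF.
pose cliqueb (K : {set T}) := [forall x in K, forall y in K, (x != y) ==> G x y].
have cliqueP K : reflect (clique G K) (cliqueb K).
  apply: (iffP forall_inP) => [h x y xK yK|h x xK].
    by have /forall_inP/(_ y yK)/implyP := h x xK; apply.
  by apply/forall_inP => y yK; apply/implyP; apply: h.
pose W (K : {set T}) := \sum_(v in K) (#|T| + degree G v).
have c0 : cliqueb set0 by apply/cliqueP => x; rewrite inE.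
pose K := [arg max_(K > set0 | cliqueb K) W K].
have [/cliqueP Kc Kmax] : cliqueb K /\ forall K', cliqueb K' -> W K' <= W K.
  by rewrite /K; case: arg_maxnP.
have WU1 x (L : {set T}) : x \notin L -> W (x |: L) = #|T| + degree G x + W L.
  by move=> xL; rewrite /W big_setU1.
have WD1 u : u \in K -> W K = #|T| + degree G u + W (K :\ u).
  by move=> uK; rewrite -WU1 ?setD11 // setD1K.
have clU1 x (L : {set T}) :
    clique G L -> {in L, forall y, G x y} -> clique G (x |: L).
  move=> Lc xL y z /setU1P[->|yL] /setU1P[->|zL]; rewrite ?eqxx // => yz.
  - exact: xL.
  - by rewrite Gsym; apply: xL.
  - exact: Lc.
have clD1 u : clique G (K :\ u).
  by move=> y z /setD1P[_ yK] /setD1P[_ zK]; apply: Kc.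
have nonnbr x : x \notin K -> exists2 u, u \in K & ~~ G x u.
  move=> xK; apply/exists_inP; rewrite -negb_forall_in; apply/negP.
  move=> /forall_inP xKn; have := Kmax (x |: K).
  rewrite WU1 // => h.
  have T0 : 0 < #|T| by apply/card_gt0P; exists x.
  have : cliqueb (x |: K) by apply/cliqueP/clU1.
  by move=> /h; lia.
(* Two adjacent vertices outside [K] have nested sets of non-neighbours in [K], since otherwise they
   span a C4 with two vertices of [K]. Here [x] is the one with the smaller set. *)
suff key x y : x \notin K -> y \notin K -> G x y ->
    (forall u, u \in K -> ~~ G x u -> ~~ G y u) -> False.
  exists (~: K); split; last by rewrite setCK.
  move=> x y; rewrite !inE => xK yK; apply/negP => xy.
  case: (boolP [exists u in K, ~~ G x u && G y u]) => [/exists_inP|].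
    case=> u uK /andP[xu yu].
    apply: (key y x) => //; first by rewrite Gsym.
    move=> w wK yw; apply/negP => xw.
    apply: (C4F x y u w); rewrite ?(negbTE xu) ?(negbTE yw) //.
    - by apply: contraNneq xK => ->.
    - by apply: contraNneq yK => ->.
    - by apply: Kc => //; apply: contraTneq yu => ->.
    - by rewrite Gsym.
  rewrite negb_exists_in => /forall_inP xyu; apply: (key x y) => // u uK xu.
  by have := xyu u uK; rewrite xu.
move=> xK yK xy xy_sub; have [u uK xu] := nonnbr x xK.
have yu := xy_sub u uK xu.
(* A second non-neighbour [w] of [x] in [K] would make [x y] and [u w] an induced 2K2. *)
have uniq_u w : w \in K -> w != u -> G x w.
  move=> wK wu; apply/negPn/negP => xw.
  have := no2K2 x y u w; rewrite /two_K2 xy xu xw yu (xy_sub w) // Kc //.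
  by rewrite eq_sym.
have xKu : {in K :\ u, forall w, G x w}.
  by move=> w /setD1P[wu wK]; apply: uniq_u.
have x_neq w : w \in K -> w != x by apply: contraTneq => ->.
have y_neq w : w \in K -> w != y by apply: contraTneq => ->.
(* Otherwise [u] could be exchanged for both [x] and [y]. The summand [#|T|] in the weight outweighs
   the degree of [u]. *)
have /existsP[w /and3P[wK wu yw]] :
    [exists w, [&& w \in K, w != u & ~~ G y w]].
  rewrite -[X in is_true X]negbK negb_exists; apply/negP => /forallP h.
  have := Kmax (y |: (x |: (K :\ u))).
  rewrite (WD1 u uK) !WU1; last 2 first.
  - by rewrite !inE (negbTE xK) andbF.
  - by rewrite !inE (negbTE yK) andbF orbF eq_sym eqF.
  have du : degree G u <= #|T| by apply: max_card.
  have dy : 0 < degree G y by apply/card_gt0P; exists x; rewrite inE Gsym.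
  move=> Kyx; suff /Kyx : cliqueb (y |: (x |: (K :\ u))) by lia.
  apply/cliqueP/clU1; first exact: clU1.
  move=> v /setU1P[->|/setD1P[vu vK]]; first by rewrite Gsym.
  by have := h v; rewrite !negb_and vK vu negbK.
have xw : G x w by apply: uniq_u.
(* Otherwise every neighbour of [u] is one of [x], while [y] is adjacent to [x] only: exchanging [u]
   for [x] would increase the degree sum. *)
have [z uz xz] : exists2 z, G u z & ~~ G x z.
  apply/exists_inP; rewrite -[X in is_true X]negbK negb_exists_in.
  apply/negP => /forall_inP h.
  have := Kmax (x |: (K :\ u)); rewrite (WD1 u uK) WU1; last first.
    by rewrite !inE (negbTE xK) andbF.
  move=> Kx; have /Kx : cliqueb (x |: (K :\ u)) by apply/cliqueP/clU1.
  rewrite leq_add2r leq_add2l; apply/negP; rewrite -ltnNge.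
  apply: proper_card; apply/properP; split.
    by apply/subsetP => v; rewrite !inE => /h; rewrite negbK.
  by exists y; rewrite inE // Gsym.
have [yz|nyz] := boolP (G y z); last first.
  by have := no2K2 x y u z; rewrite /two_K2 xy uz xu xz yu nyz.
have uw : G u w by apply: Kc => //; rewrite eq_sym.
(* The walk x, y, z, u, w closes up to a 5-cycle; its one undecided chord [w z] leaves either the C4
   on x, w, z, y or an induced C5. *)
have [wz|nwz] := boolP (G w z).
  apply: (C4F x w z y) => //; try exact: negbTE.
  - by apply: contraNneq xu => ->; rewrite Gsym.
  - exact: y_neq.
  - by rewrite Gsym.
  - by rewrite Gsym.
  - by rewrite Gsym; apply: negbTE.
have := noC5 x y z u w; rewrite /ind_C5 xy yz (Gsym z u) uz uw (Gsym w x) xw.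
by rewrite xz xu yu yw (Gsym z w) nwz.
Qed.

(** * Finite checks around 2K2, C5 and P4 *)

Definition rows_2K2 : seq bitseq :=
  [:: [::]; [:: true]; [:: false; false]; [:: false; false; true]].

Definition mixed (r : bitseq) : bool := has id r && ~~ all id r.

Definition U_adj (i j : nat) : bool :=
  ((i, j) \in U_edges) || ((j, i) \in U_edges).

Definition same_graph (e h : nat -> nat -> bool) (p : seq nat) : bool :=
  all (fun i => all (fun j => e (nth 0 p i) (nth 0 p j) == h i j) (iota 0 6))
    (iota 0 6).

(** Both outside vertices hang as leaves on the same vertex of the 2K2, as in K_2 + K_{1,m}. *)
Definition star_rows (ru rv : bitseq) (uv : bool) : bool :=
  [&& count id ru == 1, rv == ru & ~~ uv].

(* These checks rely on [lazy]: call by value, as in [vm_compute], would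
   evaluate both sides of every [==>] and [&&]. *)
Lemma pair_2K2_check :
  all (fun ru => all (fun rv =>
    let e := adj (rows_2K2 ++ [:: ru; rv]) in
    let r := take 4 rv in let uv := nth false rv 4 in
    ~~ in_calB e (iota 0 6) ==>
    [&& ~~ has id ru && ~~ all id r ==> ~~ uv,
        all id ru && has id r ==> uv &
        mixed ru && mixed r ==>
        star_rows ru r uv || has (fun p => same_graph e U_adj p ||
          same_graph e (fun i j => (i != j) && ~~ U_adj i j) p)
          (permutations (iota 0 6))])
   (bitseqs 5)) (bitseqs 4).
Proof. lazy. by []. Qed.

(** Two mixed vertices may complete the 2K2 to [U] or to its complement; a third one excludes this
    and leaves only the star pattern. The six-vertex subsets tested last omit one of the positions 0
    to 5; the one omitting position 6 is the condition imposed on [ru] and [rv]. *)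
Lemma triple_2K2_check :
  all (fun ru => mixed ru ==> all (fun rv =>
    let e := adj (rows_2K2 ++ [:: ru; rv]) in
    mixed (take 4 rv) && ~~ in_calB e (iota 0 6) ==> all (fun rt =>
      let e := adj (rows_2K2 ++ [:: ru; rv; rt]) in
      mixed (take 4 rt) &&
      all (fun i => ~~ in_calB e (rem i (iota 0 7))) (iota 0 6) ==>
      star_rows ru (take 4 rv) (nth false rv 4) &&
      star_rows ru (take 4 rt) (nth false rt 4))
    (bitseqs 6)) (bitseqs 5)) (bitseqs 4).
Proof. lazy. by []. Qed.

Lemma C5_check :
  all (fun ru =>
    ~~ in_calB (adj [:: [::]; [:: true]; [:: false; true];
                        [:: false; false; true];
                        [:: true; false; false; true]; ru])
        (iota 0 6) ==> all id ru || ~~ has id ru) (bitseqs 5).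
Proof. lazy. by []. Qed.

(** Dropping a vertex of the 5-cycle leaves a P4 and makes room for two outside vertices among
    six. *)
Lemma P4_check :
  all (fun ru => all (fun rv =>
    let e := adj [:: [::]; [:: true]; [:: false; true];
                     [:: false; false; true]; ru; rv] in
    let r := take 4 rv in let uv := nth false rv 4 in
    ~~ in_calB e (iota 0 6) ==>
    [&& ~~ has id ru && ~~ has id r ==> ~~ uv & all id ru && all id r ==> uv])
   (bitseqs 5)) (bitseqs 4).
Proof. lazy. by []. Qed.

(** * Complementation and the star family *)

Lemma embeds_onto_bij (T T' T'' : finType) (G : rel T) (A : {set T})
    (H : rel T') (K : rel T'') (h : T'' -> T') :
  bijective h -> (forall x y, H (h x) (h y) = K x y) ->
  embeds_onto G A H -> embeds_onto G A K.
Proof.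
move=> h_bij hK [f [f_inj <- fH]]; exists (f \o h); split.
- exact: inj_comp f_inj (bij_inj h_bij).
- suff <- : h @: setT = setT by exact: imset_comp.
  apply/setP=> y; rewrite inE.
  by have [k _ kK] := h_bij; apply/imsetP; exists (k y); rewrite ?kK.
- by move=> x y; rewrite /= fH hK.
Qed.

Lemma embeds_onto_ext (T T' : finType) (G G' : rel T) (A : {set T})
    (H H' : rel T') :
  G =2 G' -> H =2 H' -> embeds_onto G A H -> embeds_onto G' A H'.
Proof.
move=> GG' HH' [f [f_inj fA fH]]; exists f; split=> // x y.
by rewrite -GG' fH HH'.
Qed.

Lemma complK (T : finType) (G : sgraph T) : compl (compl G) =2 G.
Proof.
by move=> x y; rewrite !complE; case: eqP => //= [->|_]; rewrite ?edge_irr ?negbK.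
Qed.

Lemma embeds_onto_compl (T T' : finType) (G : sgraph T) (A : {set T})
    (H : sgraph T') :
  embeds_onto (compl G) A H <-> embeds_onto G A (compl H).
Proof.
suff gen (S S' : finType) (K : sgraph S) B (L : sgraph S') :
    embeds_onto K B L -> embeds_onto (compl K) B (compl L).
  split=> /gen; first by apply: embeds_onto_ext => //; apply: complK.
  by apply: embeds_onto_ext => // x y; rewrite complK.
case=> f [f_inj fB fL]; exists f; split=> // x y.
by rewrite !complE fL inj_eq.
Qed.

Definition K2_star m := disjoint_union (complete 2) (star m).

Definition co_K2_star m :=
  join (disjoint_union (complete m) (complete 1))
       (disjoint_union (complete 1) (complete 1)).

(** Under complementation the leaves become K_m, the centre becomes the K_1 beside it, and the edge
    K_2 becomes the joined 2K_1. *)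
Lemma embeds_onto_co_K2_star (T : finType) (G : sgraph T) (A : {set T}) m :
  embeds_onto G A (co_K2_star m) <-> embeds_onto (compl G) A (K2_star m).
Proof.
pose h (u : ('I_m + 'I_1) + ('I_1 + 'I_1)) : 'I_2 + 'I_m.+1 :=
  match u with
  | inl (inl i) => inr (lift ord0 i)
  | inl (inr _) => inr ord0
  | inr (inl _) => inl ord0
  | inr (inr _) => inl ord_max
  end.
pose k (v : 'I_2 + 'I_m.+1) : ('I_m + 'I_1) + ('I_1 + 'I_1) :=
  match v with
  | inl i => inr (if i == ord0 then inl ord0 else inr ord0)
  | inr j => inl (if unlift ord0 j is Some i then inl i else inr ord0)
  end.
have hK : cancel h k.
  case=> [[i|i]|[i|i]] /=; rewrite ?liftK ?unlift_none ?(ord1 i) //.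
have kK : cancel k h.
  case=> [[[|[|//]] i]|j] /=.
  - by congr inl; apply: val_inj.
  - by congr inl; apply: val_inj.
  - by case: unliftP => [i ->|->].
have hE x y : compl (K2_star m) (h x) (h y) = co_K2_star m x y.
  rewrite complE (can_eq hK).
  case: x y => [[i|i]|[i|i]] [[j|j]|[j|j]] //; try by rewrite ?(ord1 i) ?(ord1 j).
  exact: andbT.
rewrite embeds_onto_compl; split; apply: embeds_onto_bij.
- by exists h.
- by move=> x y; rewrite -hE !kK.
- by exists k.
- exact: hE.
Qed.

(** Adjacency in K_2 + K_{1,m} as seen from the centre [a] and the separate edge [c d]; every other
    vertex is a leaf, so [m] is determined by the number of vertices. *)
Definition star_pattern (T : eqType) (a c d x y : T) : bool :=
  if x == a then y \notin [:: a; c; d] else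
  if y == a then x \notin [:: a; c; d] else
  (x == c) && (y == d) || (x == d) && (y == c).

Definition star_in (T : finType) (G : rel T) (A : {set T}) (a c d : T) : Prop :=
  [/\ uniq [:: a; c; d], {subset [:: a; c; d] <= A}, 5 < #|A| &
      {in A &, forall x y, G x y = star_pattern a c d x y}].

Lemma star_pattern_inj (T : eqType) m (f : 'I_2 + 'I_m.+1 -> T) u v :
  injective f ->
  star_pattern (f (inr ord0)) (f (inl ord0)) (f (inl ord_max)) (f u) (f v) =
  K2_star m u v.
Proof.
move=> f_inj; rewrite /star_pattern !inE !(inj_eq f_inj).
case: u v => [[[|[|//]] ?]|[[|?] ?]] [[[|[|//]] ?]|[[|?] ?]] //.
Qed.

Lemma star_inP (T : finType) (G : rel T) (A : {set T}) :
  (exists a c d, star_in G A a c d) <->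
  (exists2 m, 2 < m & embeds_onto G A (K2_star m)).
Proof.
split=> [[a [c [d [acd_uniq acdA A6 Gpat]]]]|[m m3 [f [f_inj fA fG]]]].
  pose L := enum (A :\: [set x in [:: a; c; d]]).
  have sizeL : #|A| = (size L).+3.
    rewrite -cardE -(cardsID [set x in [:: a; c; d]] A) (setIidPr _).
      by rewrite cardsE (card_uniqP acd_uniq).
    by apply/subsetP=> x; rewrite inE => /acdA.
  exists (size L); first by rewrite sizeL in A6.
  (* The list follows ['I_2 + 'I_m.+1]: the edge, the centre at position 2, then the leaves. *)
  pose s := [:: c, d, a & L].
  have s_uniq : uniq s.
    rewrite /s /= !inE !mem_enum !inE !eqxx !orbT /= !orbF.
    rewrite enum_uniq andbT; move: acd_uniq; rewrite /= !inE !negb_or.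
    by rewrite (eq_sym c a) (eq_sym d a) => /andP[/andP[-> ->] ->].
  pose g (u : 'I_2 + 'I_(size L).+1) : nat :=
    match u with inl i => i | inr j => j.+2 end.
  have g_inj : injective g.
    case=> [[i i2]|j] [[k k2]|l] //= e.
    - by congr inl; apply: val_inj.
    - by move: (i2); rewrite e.
    - by move: (k2); rewrite -e.
    - by congr inr; apply: val_inj; case: e.
  have g_lt u : g u < size s 
    by case: u => [i|j]; [have := ltn_ord i | have := ltn_ord j]; rewrite /=; lia.
  have f_inj : injective (fun u => nth a s (g u)).
    by move=> u v /eqP; rewrite nth_uniq // => /eqP/g_inj.
  have fA u : nth a s (g u) \in A.
    have := mem_nth a (g_lt u); rewrite !inE mem_enum !inE.
    by case/or4P=> [/eqP->|/eqP->|/eqP->|/andP[]//]; apply: acdA;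
      rewrite !inE eqxx ?orbT.
  exists (fun u => nth a s (g u)); split=> //.
    apply/eqP; rewrite eqEcard; apply/andP; split.
      by apply/subsetP=> _ /imsetP[u _ ->].
    by rewrite card_imset // cardsT card_sum !card_ord sizeL.
  by move=> u v; rewrite Gpat // -(star_pattern_inj u v f_inj).
exists (f (inr ord0)), (f (inl ord0)), (f (inl ord_max)); split.
- by rewrite /= !inE !(inj_eq f_inj).
- by move=> x; rewrite !inE -fA => /or3P[]/eqP->; apply: imset_f.
- by rewrite -fA card_imset // cardsT card_sum !card_ord.
- move=> x y; rewrite -fA => /imsetP[u _ ->] /imsetP[v _ ->].
  by rewrite fG star_pattern_inj.
Qed.

Lemma card_set_sig (T : finType) (A : {set T}) : #|{: {x | x \in A}}| = #|A|.
Proof. by rewrite card_sig; apply: eq_card. Qed.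

Lemma core_graph_compl (T : finType) (G : sgraph T) (A : {set T}) :
  core_graph (induced (compl G) A) -> core_graph (induced G A).
Proof.
case=> [[B [Bind Bcl]]|A6|/induced_embeds/embeds_onto_compl/induced_embeds UG|].
- constructor 1; exists (~: B); split.
    move=> x y xB yB; have [->|xy] := eqVneq x y; first by rewrite edge_irr.
    by have /andP[] := Bcl x y xB yB xy.
  rewrite setCK => x y xB yB xy; have := Bind x y xB yB.
  rewrite [induced _ _ _ _]complE negb_and !negbK => /orP[/eqP/val_inj xy'|//].
  by rewrite xy' eqxx in xy.
- by constructor 2.
- by constructor 4; constructor 1.
case=> [/induced_embeds/embeds_onto_compl UG|[m m3 /induced_embeds SG]|].
- constructor 3; apply/induced_embeds.
  by apply: embeds_onto_ext UG => //; apply: complK.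
- constructor 4; constructor 3; exists m => //.
  exact/induced_embeds/embeds_onto_co_K2_star.
case=> m m3 /induced_embeds/embeds_onto_co_K2_star SG.
constructor 4; constructor 2; exists m => //; apply/induced_embeds.
by apply: embeds_onto_ext SG => //; apply: complK.
Qed.

(** Complementing exchanges the roles of [V1] and [V2] and keeps [V3]. *)
Lemma has_core_partition_compl (T : finType) (G : sgraph T) :
  has_core_partition (compl G) -> has_core_partition G.
Proof.
case=> V1 [V2 [V3 [cov [d12 d13 d23] [V1i V2c] V3adj /core_graph_compl V3core]]].
exists V2, V1, V3; split=> //.
- by rewrite (setUC V2).
- by rewrite disjoint_sym.
- split=> [x y xV yV|x y xV yV xy].
    have [->|xy] := eqVneq x y; first by rewrite edge_irr.
    by have /andP[] := V2c x y xV yV xy.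
  by have := V1i x y xV yV; rewrite complE xy negbK.
move=> x xV; have [V2x V1x] := V3adj x xV; split=> y yV.
  have := V1x y yV; rewrite complE negb_and !negbK => /orP[/eqP xy|//].
  by have := disjointFr d13 yV; rewrite -xy xV.
by have /andP[] := V2x y yV.
Qed.

Lemma degree_compl (T : finType) (G : sgraph T) (v : T) :
  degree G v + degree (compl G) v = #|T|.-1.
Proof.
rewrite -(cardsC [set w | G v w]) (cardsD1 v (~: _)) !inE edge_irr /=.
rewrite addnS /=; congr (_ + _); apply: eq_card => w.
by rewrite !inE complE eq_sym.
Qed.

(** Complementing replaces each degree k by 5 - k, and the table of sequences is closed under this
    up to sorting. *)
Lemma calB_compl (H : sgraph 'I_6) : calB H -> calB (compl H).
Proof.
rewrite /calB => HB.
have -> : [seq degree (compl H) v | v : 'I_6] =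
    [seq 5 - k | k <- [seq degree H v | v : 'I_6]].
  rewrite /image_mem -map_comp; apply: eq_map => v.
  by rewrite /= -[5]/(6.-1) -[X in X.-1 - _]card_ord -(degree_compl H v) addKn.
set s := [seq degree H v | v : 'I_6] in HB *.
have -> : sort geq [seq 5 - k | k <- s] = sort geq [seq 5 - k | k <- sort geq s].
  apply/perm_sortP; last by apply/perm_map; rewrite perm_sym perm_sort.
  - by move=> x y; apply: leq_total.
  - by move=> x y z xy yz; apply: leq_trans yz xy.
  - by move=> x y; rewrite andbC => /anti_leq.
move: HB; move: (sort geq s) => l lB.
suff /allP : all (fun l => sort geq [seq 5 - k | k <- l] \in calB_degrees)
  calB_degrees by apply.
by lazy.
Qed.

Lemma calB_free_compl (T : finType) (G : sgraph T) :
  calB_free G -> calB_free (compl G).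
Proof.
move=> Gfree A H HB /induced_embeds/embeds_onto_compl/induced_embeds GH.
exact: Gfree A _ (calB_compl HB) GH.
Qed.

(** * Core partitions around an induced C5 or 2K2 *)

Lemma core_of_C5 (T : finType) (G : sgraph T) a b c d e :
  calB_free G -> ind_C5 G a b c d e -> has_core_partition G.
Proof.
move=> Gfree /andP[/and5P[ab bc cd de ea] /and5P[nac nad nbd nbe nce]].
have Gsym := edge_sym G.
have symF x y : ~~ G x y -> (G x y = false) * (G y x = false).
  by move=> /negbTE xy; rewrite (Gsym y) xy.
have symT x y : G x y -> (G x y = true) * (G y x = true).
  by move=> xy; rewrite (Gsym y) xy.
pose E := (symT _ _ ab, symT _ _ bc, symT _ _ cd, symT _ _ de, symT _ _ ea,
  symF _ _ nac, symF _ _ nad, symF _ _ nbd, symF _ _ nbe, symF _ _ nce).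
have neqG x y z : G x z -> ~~ G y z -> x != y.
  by move=> xz yz; apply: contraNneq yz => <-.
have s_uniq : uniq [:: a; b; c; d; e].
  rewrite /= !inE !negb_or !andbT -!andbA.
  rewrite (neqG a b e) ?(neqG a c e) ?(neqG a d b) ?(neqG a e b) ?(neqG b c a) //;
  by rewrite ?(neqG b d a) ?(neqG b e c) ?(neqG c d b) ?(neqG c e b) ?(neqG d e c) ?E.
pose s := [:: a; b; c; d; e].
have all_or_none u : u \notin s -> all (G u) s || ~~ has (G u) s.
  move=> us; have := @calB_free_rows _ G (rcons s u) (iota 0 6) Gfree.
  rewrite rcons_uniq us s_uniq => /(_ isT isT erefl isT).
  have := mem_bitseqs (erefl (size [:: G u a; G u b; G u c; G u d; G u e])).
  move=> /(allP C5_check) /implyP h.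
  have -> : seq_rows G (rcons s u) =
      [:: [::]; [:: true]; [:: false; true]; [:: false; false; true];
          [:: true; false; false; true]; [:: G u a; G u b; G u c; G u d; G u e]].
    by rewrite /seq_rows /rows /mkseq /= !E.
  exact: h.
have pair u v : u \notin s -> v \notin s -> u != v ->
    (~~ has (G u) s && ~~ has (G v) s -> ~~ G u v) /\
    (all (G u) s && all (G v) s -> G u v).
  move=> us vs uv.
  have := @calB_free_rows _ G [:: a; b; c; d; u; v] (iota 0 6) Gfree.
  have -> : uniq [:: a; b; c; d; u; v].
    move: s_uniq us vs; rewrite /s -[[:: a, b & _]]/([:: a; b; c; d] ++ [:: e]).
    rewrite cat_uniq !mem_cat => /and3P[abcd _ _] /norP[us _] /norP[vs _].
    rewrite -[[:: a, b & _]]/(rcons (rcons [:: a; b; c; d] u) v) !rcons_uniq.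
    by rewrite mem_rcons in_cons negb_or eq_sym uv us vs.
  move=> /(_ isT isT erefl isT).
  have := mem_bitseqs (erefl (size [:: G u a; G u b; G u c; G u d])).
  move=> /(allP P4_check).
  have := mem_bitseqs (erefl (size [:: G v a; G v b; G v c; G v d; G v u])).
  move=> /[swap]/allP/[apply] /implyP h.
  have -> : seq_rows G [:: a; b; c; d; u; v] =
      [:: [::]; [:: true]; [:: false; true]; [:: false; false; true];
          [:: G u a; G u b; G u c; G u d];
          [:: G v a; G v b; G v c; G v d; G v u]].
    by rewrite /seq_rows /rows /mkseq /= !E.
  move=> /h /=; rewrite (Gsym v u).
  case/andP=> /implyP h1 /implyP h2; split.
    move=> /andP[]; rewrite !negb_or => /and5P[? ? ? ? _] /and5P[? ? ? ? _].
    by apply: h1; rewrite !negb_or; apply/andP; split; apply/and5P.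
  move=> /andP[/and5P[? ? ? ? _] /and5P[? ? ? ? _]].
  by apply: h2; apply/andP; split; apply/and5P.
(* [V3] is the 5-cycle itself, a core because it has fewer than six vertices. *)
pose V1 := [set u | (u \notin s) && ~~ has (G u) s].
pose V2 := [set u | (u \notin s) && all (G u) s].
exists V1, V2, [set u in s]; split.
- apply/setP=> u; rewrite !in_setU !in_set.
  case: (boolP (u \in s)) => us; first by rewrite orbT.
  by rewrite orbF orbC; exact: all_or_none.
- split; rewrite disjoints_subset; apply/subsetP => u.
  + rewrite in_setC !in_set => /andP[-> /=].
    by apply: contra => /andP[ua _]; apply/orP; left.
  + by rewrite in_setC !in_set => /andP[].
  + by rewrite in_setC !in_set => /andP[].
- split=> u v; rewrite !in_set => /andP[us hu] /andP[vs hv].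
    have [->|uv] := eqVneq u v; first by rewrite edge_irr.
    by have [h _] := pair u v us vs uv; apply: h; rewrite hu hv.
  by move=> uv; have [_ h] := pair u v us vs uv; apply: h; rewrite hu hv.
- move=> x; rewrite in_set => xs; split=> u; rewrite in_set => /andP[_ hu].
    by rewrite Gsym; apply: (allP hu).
  by rewrite Gsym; apply: contra hu => ux; apply/hasP; exists x.
- by constructor 2; rewrite card_set_sig cardsE (card_uniqP s_uniq).
Qed.

Lemma embeds_of_same_graph (T : finType) (G : sgraph T) (s : seq T)
    (p : seq nat) (h : nat -> nat -> bool) (H : rel 'I_6) :
  uniq s -> size s = 6 -> p \in permutations (iota 0 6) ->
  same_graph (adj (seq_rows G s)) h p -> (forall i j : 'I_6, H i j = h i j) ->
  embeds_onto G [set x in s] H.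
Proof.
move=> s_uniq s6; rewrite mem_permutations => p_perm sp Hh.
have p6 : size p = 6 by rewrite (perm_size p_perm).
have p_uniq : uniq p by rewrite (perm_uniq p_perm) iota_uniq.
have p_lt (i : 'I_6) : nth 0 p i < size s.
  have := mem_nth 0 (_ : i < size p); rewrite p6 => /(_ (ltn_ord i)).
  by rewrite (perm_mem p_perm) mem_iota s6.
case: s s_uniq s6 sp p_lt => [//|x0 s'] s_uniq s6 sp p_lt.
set s := x0 :: s' in s_uniq s6 sp p_lt *.
have f_inj : injective (fun i : 'I_6 => nth x0 s (nth 0 p i)).
  move=> i j /eqP; rewrite nth_uniq // nth_uniq ?p6 //.
  by move=> /eqP/val_inj.
exists (fun i : 'I_6 => nth x0 s (nth 0 p i)); split=> //.
  apply/eqP; rewrite eqEcard; apply/andP; split.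
    by apply/subsetP=> _ /imsetP[i _ ->]; rewrite inE mem_nth.
  by rewrite card_imset // cardsT card_ord cardsE (card_uniqP s_uniq) s6.
move=> i j; rewrite Hh -(adj_seq_rows G x0) //.
have io (k : 'I_6) : (k : nat) \in iota 0 6 by rewrite mem_iota /=.
by have /eqP := allP (allP sp i (io i)) j (io j).
Qed.

Lemma star_of_leaves (T : finType) (G : sgraph T) (A : {set T}) a c d :
  uniq [:: a; c; d] -> {subset [:: a; c; d] <= A} -> 5 < #|A| ->
  G c d -> ~~ G a c -> ~~ G a d ->
  {in A, forall x, x \notin [:: a; c; d] ->
    [/\ G x a, ~~ G x c & ~~ G x d]} ->
  {in A &, forall x y, x \notin [:: a; c; d] -> y \notin [:: a; c; d] ->
    ~~ G x y} ->
  star_in G A a c d.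
Proof.
move=> acd_uniq acdA A6 cd ac ad leaf leaves; split=> // x y xA yA.
have Gsym := edge_sym G; move: acd_uniq.
rewrite /= !inE negb_or andbT => /andP[/andP[nac nad] ncd].
have pos z : [\/ z = a, z = c, z = d | z \notin [:: a; c; d]].
  case: (boolP (z \in [:: a; c; d])); last by constructor 4.
  by rewrite !inE => /or3P[]/eqP->; [constructor 1|constructor 2|constructor 3].
have E := (eqxx, eq_sym c a, eq_sym d a, eq_sym d c, negbTE nac, negbTE nad,
  negbTE ncd, edge_irr, cd, Gsym d c, Gsym c a, Gsym d a, negbTE ac, negbTE ad).
have nE z : z \notin [:: a; c; d] ->
    ((z == a = false) * (z == c = false) * (z == d = false))%type.
  by rewrite !inE !negb_or => /and3P[/negbTE-> /negbTE-> /negbTE->].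
rewrite /star_pattern.
case: (pos x) (pos y) => [->|->|->|xn] [->|->|->|yn]; rewrite ?inE ?E //=.
- by rewrite !(nE y yn) Gsym; have [] := leaf y yA yn.
- by rewrite !(nE y yn) Gsym; have [_ /negbTE] := leaf y yA yn.
- by rewrite !(nE y yn) Gsym; have [_ _ /negbTE] := leaf y yA yn.
- by rewrite !(nE x xn); have [] := leaf x xA xn.
- by rewrite !(nE x xn); have [_ /negbTE] := leaf x xA xn.
- by rewrite !(nE x xn); have [_ _ /negbTE] := leaf x xA xn.
- by rewrite !(nE x xn) !(nE y yn); apply/negbTE/leaves.
Qed.

Lemma two_K2_uniq (T : finType) (G : sgraph T) a b c d :
  two_K2 G a b c d -> uniq [:: a; b; c; d].
Proof.
case/and5P=> ab cd nac nad /andP[nbc nbd]; have Gsym := edge_sym G.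
have neqG x y z : G x z -> ~~ G y z -> x != y.
  by move=> xz yz; apply: contraNneq yz => <-.
rewrite /= !inE !negb_or !andbT -!andbA.
rewrite (neqG a b b) ?edge_irr // (neqG a c b) ?(neqG a d b) ?(neqG b c a) //;
by rewrite ?(neqG b d a) ?(neqG c d d) ?edge_irr // Gsym.
Qed.

(** [V3] consists of the four vertices of the 2K2 and a set [M] of mixed outside vertices. If [M]
    has at most one element, [V3] has fewer than six vertices; if it has two, the pair check leaves
    the star pattern, [U] or its complement; if it has three or more, every pair is a star
    pattern. *)
Lemma core_of_2K2 (T : finType) (G : sgraph T) a b c d :
  calB_free G -> two_K2 G a b c d -> has_core_partition G.
Proof.
move=> Gfree abcd; have s_uniq := two_K2_uniq abcd.
case/and5P: abcd => ab cd nac nad /andP[nbc nbd]; have Gsym := edge_sym G.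
have symF x y : ~~ G x y -> (G x y = false) * (G y x = false).
  by move=> /negbTE xy; rewrite (Gsym y) xy.
have symT x y : G x y -> (G x y = true) * (G y x = true).
  by move=> xy; rewrite (Gsym y) xy.
have E := (symT _ _ ab, symT _ _ cd, symF _ _ nac, symF _ _ nad,
  symF _ _ nbc, symF _ _ nbd, edge_irr G).
pose s := [:: a; b; c; d]; pose row u := map (G u) s.
have rowsE u v : seq_rows G (s ++ [:: u; v]) =
    rows_2K2 ++ [:: row u; rcons (row v) (G v u)].
  by rewrite /seq_rows /rows /mkseq /= !E.
have s2_uniq u v : u \notin s -> v \notin s -> u != v -> uniq (s ++ [:: u; v]).
  move=> us vs uv; rewrite cat_uniq s_uniq andTb.
  apply/andP; split; last by rewrite /= inE uv.
  by rewrite -all_predC; apply/and3P; split.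
have pair u v : u \notin s -> v \notin s -> u != v ->
    [&& ~~ has id (row u) && ~~ all id (row v) ==> ~~ G v u,
        all id (row u) && has id (row v) ==> G v u &
        mixed (row u) && mixed (row v) ==>
        star_rows (row u) (row v) (G v u) || has (fun p =>
          same_graph (adj (seq_rows G (s ++ [:: u; v]))) U_adj p ||
          same_graph (adj (seq_rows G (s ++ [:: u; v])))
            (fun i j => (i != j) && ~~ U_adj i j) p)
          (permutations (iota 0 6))].
  move=> us vs uv.
  have := @calB_free_rows _ G (s ++ [:: u; v]) (iota 0 6) Gfree.
  rewrite s2_uniq // rowsE => /(_ isT isT erefl isT).
  have /(allP pair_2K2_check) := mem_bitseqs (erefl (size (row u))).
  have := mem_bitseqs (erefl (size (rcons (row v) (G v u)))).
  by move=> /[swap]/allP/[apply]/implyP; apply.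
have triple u v t : uniq [:: u; v; t] -> u \notin s -> v \notin s ->
    t \notin s -> mixed (row u) -> mixed (row v) -> mixed (row t) ->
    star_rows (row u) (row v) (G v u).
  move=> uvt us vs ts mu mv mt; move: uvt.
  rewrite /= !inE negb_or andbT => /andP[/andP[uv ut] vt].
  have s3_uniq : uniq (s ++ [:: u; v; t]).
    rewrite cat_uniq s_uniq andTb; apply/andP; split.
      by rewrite -all_predC; apply/and4P; split.
    by rewrite /= !inE !negb_or uv ut vt.
  have rE : seq_rows G (s ++ [:: u; v; t]) = rows_2K2 ++
      [:: row u; rcons (row v) (G v u); rcons (rcons (row t) (G t u)) (G t v)].
    by rewrite /seq_rows /rows /mkseq /= !E.
  have free2 : ~~ in_calB (adj (rows_2K2 ++
      [:: row u; rcons (row v) (G v u)])) (iota 0 6).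
    by rewrite -rowsE; apply: calB_free_rows; rewrite ?s2_uniq.
  have free3 : all (fun i => ~~ in_calB (adj (rows_2K2 ++ [:: row u;
      rcons (row v) (G v u); rcons (rcons (row t) (G t u)) (G t v)]))
      (rem i (iota 0 7))) (iota 0 6).
    rewrite -rE; apply/allP => i; rewrite mem_iota add0n => i6.
    apply: calB_free_rows => //.
    - by rewrite rem_uniq ?iota_uniq.
    - by rewrite size_rem // mem_iota (ltn_trans i6).
    - by apply/allP => j /mem_rem; rewrite mem_iota.
  have h1 := allP triple_2K2_check _ (mem_bitseqs (erefl (size (row u)))).
  have h2 := allP (implyP h1 mu) _
    (mem_bitseqs (erefl (size (rcons (row v) (G v u))))).
  have h3 := allP (implyP h2 (introT andP (conj mv free2))) _
    (mem_bitseqs (erefl (size (rcons (rcons (row t) (G t u)) (G t v))))).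
  by have /andP[] := implyP h3 (introT andP (conj mt free3)).
pose V1 := [set u | ~~ has id (row u)]; pose V2 := [set u | all id (row u)].
pose V3 := [set u | mixed (row u)].
have sV3 : {subset s <= V3}.
  by move=> u; rewrite !inE => /or4P[]/eqP->; rewrite /mixed /= !E.
have V3E u : (u \in V3) = mixed (row u) by rewrite inE.
have V1E u : (u \in V1) = ~~ has id (row u) by rewrite inE.
have V2E u : (u \in V2) = all id (row u) by rewrite inE.
have all_has u : all id (row u) -> has id (row u) by case/andP=> /= ->.
have s_mixed u : u \in s -> mixed (row u) by move/sV3; rewrite V3E.
have V1s u : u \in V1 -> u \notin s.
  by rewrite V1E; apply: contraNN => /s_mixed/andP[].
have V2s u : u \in V2 -> u \notin s.
  by rewrite V2E; apply: contraTN => /s_mixed/andP[].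
exists V1, V2, V3; split.
- apply/setP => u; rewrite !in_setU V1E V2E V3E in_setT /mixed.
  by case: (has _ _) (all _ _) => [] [].
- split; rewrite disjoints_subset; apply/subsetP => u; rewrite in_setC.
  + by rewrite V1E V2E; apply: contra; apply: all_has.
  + by rewrite V1E V3E; apply: contra => /andP[].
  + by rewrite V2E V3E /mixed => ->; rewrite andbF.
- split=> u v uV vV.
    have [->|uv] := eqVneq u v; first by rewrite edge_irr.
    rewrite eq_sym in uv.
    have /and3P[/implyP h _ _] := pair v u (V1s v vV) (V1s u uV) uv; apply: h.
    rewrite V1E in uV; rewrite V1E in vV; rewrite vV.
    by apply: contra uV; apply: all_has.
  move=> uv; rewrite Gsym.
  have /and3P[_ /implyP h _] := pair u v (V2s u uV) (V2s v vV) uv; apply: h.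
  by rewrite V2E in uV; rewrite V2E in vV; rewrite uV all_has.
- move=> x; rewrite V3E => xm; case/andP: (xm) => xh xa; split=> u uV.
    have us := V2s u uV; rewrite V2E in uV.
    have ux : u != x by apply: contraNneq xa => <-.
    have [xs|xs] := boolP (x \in s).
      by rewrite Gsym; apply: (allP uV); apply: map_f.
    by have /and3P[_ /implyP h _] := pair u x us xs ux; apply: h; rewrite uV.
  have us := V1s u uV; rewrite V1E in uV.
  have ux : u != x by apply: contraNneq uV => ->.
  have [xs|xs] := boolP (x \in s).
    rewrite Gsym; apply: contra uV => ux'.
    by apply/hasP; exists (G u x) => //; apply: map_f.
  by have /and3P[/implyP h _ _] := pair u x us xs ux; apply: h; rewrite uV.
pose M := V3 :\: [set x in s].
have MP u : u \in M -> (u \notin s) * mixed (row u).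
  by rewrite !inE -V3E inE => /andP[].
have cardV3 : #|V3| = 4 + #|M|.
  rewrite -(cardsID [set x in s] V3) (setIidPr _).
    by rewrite cardsE (card_uniqP s_uniq).
  by apply/subsetP => u; rewrite inE => /sV3.
have stars : 1 < #|M| ->
    {in M &, forall u v, u != v -> star_rows (row u) (row v) (G v u)} ->
    exists a c d, star_in G V3 a c d.
  move=> M2 Mstar.
  have /card_gt1P[u0 [u1 [u0M u1M u01]]] := M2.
  have /and3P[r1 _ _] := Mstar u0 u1 u0M u1M u01.
  have Mrow v : v \in M -> row v = row u0.
    move=> vM; have [->//|vu] := eqVneq v u0.
    by rewrite eq_sym in vu; have /and3P[_ /eqP] := Mstar u0 v u0M vM vu.
  have Mind u v : u \in M -> v \in M -> G u v = false.
    move=> uM vM; have [->|uv] := eqVneq u v; first by rewrite edge_irr.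
    rewrite eq_sym in uv.
    by have /and3P[_ _ /negbTE] := Mstar v u vM uM uv.
  (* The common neighbour of the vertices of [M] may be any of the four; relabelled as [a'], it is
     the centre, its partner [b'] is one more leaf, and [c' d'] is the separate edge. *)
  have build a' b' c' d' : perm_eq [:: a'; b'; c'; d'] s -> G b' a' ->
      G c' d' -> ~~ G a' c' -> ~~ G a' d' -> ~~ G b' c' -> ~~ G b' d' ->
      (forall u, u \in M -> [&& G u a', ~~ G u b', ~~ G u c' & ~~ G u d']) ->
      exists a c d, star_in G V3 a c d.
    move=> ps ba' cd' ac' ad' bc' bd' M'; exists a', c', d'.
    have := perm_uniq ps; rewrite s_uniq /= !inE !negb_or !andbT.
    move=> /andP[/and3P[ab_ ac_ ad_] /andP[/andP[bc_ bd_] cd_]].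
    have cases u : u \in V3 -> u \notin [:: a'; c'; d'] -> u = b' \/ u \in M.
      move=> uV3 uacd; have [uM|uM] := boolP (u \in M); [by right|left].
      move: uM; rewrite in_setD uV3 andbT negbK inE -(perm_mem ps).
      move: uacd; rewrite !inE !negb_or => /and3P[/negbTE-> /negbTE-> /negbTE->].
      by rewrite !orbF => /eqP.
    apply: star_of_leaves => //.
    - by rewrite /= !inE negb_or ac_ ad_ cd_.
    - move=> u uacd; apply: sV3; rewrite -(perm_mem ps).
      by move: uacd; rewrite !inE => /or3P[]->; rewrite ?orbT.
    - by rewrite cardV3 (leq_add2l 4 2).
    - by move=> u uV3 /(cases u uV3)[->|/M' /and4P[-> _ -> ->]].
    - move=> u v uV3 vV3 /(cases u uV3)[->|uM] /(cases v vV3)[->|vM].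
      + by rewrite edge_irr.
      + by rewrite Gsym; have /and4P[] := M' v vM.
      + by have /and4P[] := M' u uM.
      + by rewrite Mind.
  have M_row : forall u, u \in M -> row u = row u0 by [].
  have row1 : [\/ row u0 = [:: true; false; false; false],
      row u0 = [:: false; true; false; false],
      row u0 = [:: false; false; true; false] |
      row u0 = [:: false; false; false; true]].
    move: r1; rewrite /row /=.
    by case: (G u0 a) (G u0 b) (G u0 c) (G u0 d) => [] [] [] [] //= _;
      [constructor 1|constructor 2|constructor 3|constructor 4].
  case: row1 => r.
  - apply: (build a b c d); rewrite ?E //.
    by move=> u /M_row; rewrite r => -[-> -> -> ->].
  - apply: (build b a c d); rewrite ?E //.
      by rewrite (perm_catCA [:: b] [:: a] [:: c; d]).
    by move=> u /M_row; rewrite r => -[-> -> -> ->].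
  - apply: (build c d a b); rewrite ?E //.
      by rewrite (perm_catC [:: c; d] [:: a; b]).
    by move=> u /M_row; rewrite r => -[-> -> -> ->].
  - apply: (build d c a b); rewrite ?E //.
      by rewrite (perm_catCA [:: d] [:: c]) (perm_catC [:: c; d] [:: a; b]).
    by move=> u /M_row; rewrite r => -[-> -> -> ->].
have stars_core : (exists a c d, star_in G V3 a c d) ->
    core_graph (induced G V3).
  move=> /star_inP[m m3 /induced_embeds SG].
  by constructor 4; constructor 2; exists m.
have [M_le1|M2] := leqP #|M| 1.
  by constructor 2; rewrite card_set_sig cardV3 ltnS (leq_add2l 4 _ 1).
have [M_le2|M3] := leqP #|M| 2; last first.
  apply/stars_core/stars => // u v uM vM uv.
  have [t tM] : exists t, t \in M :\: [set u; v].
    apply/set0Pn; rewrite -card_gt0 cardsD subn_gt0 (leq_ltn_trans _ M3) //.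
    by rewrite (leq_trans (subset_leq_card (subsetIr _ _))) // cards2 uv.
  move: tM; rewrite in_setD in_set2 negb_or => /andP[/andP[tu tv] tM].
  apply: (triple u v t); rewrite ?MP //.
  by rewrite /= !inE negb_or uv !(eq_sym _ t) tu tv.
have /cards2P[u [v [uv ME]]] : #|M| == 2 by rewrite eqn_leq M_le2.
have uM : u \in M by rewrite ME set21.
have vM : v \in M by rewrite ME set22.
have V3s : V3 = [set x in s ++ [:: u; v]].
  apply/eqP; rewrite eq_sym eqEcard cardV3 ME cards2 uv cardsE.
  rewrite (card_uniqP _) ?s2_uniq ?MP // andbT.
  apply/subsetP => x; rewrite inE mem_cat => /orP[/sV3//|].
  move: uM vM; rewrite !in_setD => /andP[_ uV3] /andP[_ vV3].
  by rewrite in_cons mem_seq1 => /orP[]/eqP->.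
have /and3P[_ _ /implyP h] := pair u v (MP u uM).1 (MP v vM).1 uv.
rewrite !MP // in h; case/orP: (h isT) => [st|/hasP[p pperm]].
  apply/stars_core/stars => // x y.
  rewrite ME !in_set2 => /orP[]/eqP-> /orP[]/eqP->; rewrite ?eqxx // => _.
  by case/and3P: st => r1 /eqP rv nuv; rewrite /star_rows rv r1 eqxx Gsym.
have emb h' H := @embeds_of_same_graph _ G (s ++ [:: u; v]) p h' H.
rewrite s2_uniq ?MP // in emb.
case/orP=> sg.
  constructor 3; apply/induced_embeds; rewrite V3s.
  exact: (emb U_adj _ isT erefl pperm sg).
constructor 4; constructor 1; apply/induced_embeds; rewrite V3s.
exact: (emb (fun i j => (i != j) && ~~ U_adj i j) _ isT erefl pperm sg).
Qed.

Lemma core_of_calB_free (T : finType) (G : sgraph T) :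
  calB_free G -> has_core_partition G.
Proof.
move=> Gfree.
have [/existsP[a /existsP[b /existsP[c /existsP[d]]]]|no2K2] :=
  boolP [exists a, exists b, exists c, exists d, two_K2 G a b c d].
  exact: core_of_2K2.
have [/existsP[a /existsP[b /existsP[c /existsP[d]]]]|noC4] :=
  boolP [exists a, exists b, exists c, exists d, two_K2 (compl G) a b c d].
  by move=> /(core_of_2K2 (calB_free_compl Gfree))/has_core_partition_compl.
have [|noC5] := boolP [exists a, exists b, exists c, exists d, exists e,
                        ind_C5 G a b c d e].
  case/existsP=> a /existsP[b /existsP[c /existsP[d /existsP[e]]]].
  exact: core_of_C5.
have [A [Aind Acl]] : split_graph G.
  apply: split_of_obstruction_free.
  - move=> a b c d; apply: contra no2K2 => h.
    by apply/existsP; exists a; apply/existsP; exists b; apply/existsP; exists c;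
      apply/existsP; exists d.
  - move=> a b c d; apply: contra noC4 => h.
    by apply/existsP; exists a; apply/existsP; exists b; apply/existsP; exists c;
      apply/existsP; exists d.
  - move=> a b c d e; apply: contra noC5 => h.
    by apply/existsP; exists a; apply/existsP; exists b; apply/existsP; exists c;
      apply/existsP; exists d; apply/existsP; exists e.
(* A split graph is covered by [V1] and [V2]; the empty [V3] counts as a core with fewer than six
   vertices. *)
exists A, (~: A), set0; split=> //.
- by rewrite setU0 setUCr.
- by split; rewrite ?disjoints_subset ?setCK ?setC0 ?subsetT.
- by move=> x; rewrite inE.
- by constructor 2; rewrite card_set_sig cards0.
Qed.

(** * Blossoms *)

(** Only pairs inside the image of [f] are changed, so it is enough to match the degrees within that
    image. *)
Lemma degree_preserving_replace (T T' : finType) (G : sgraph T) (K : sgraph T')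
    (f : T' -> T) :
  injective f -> (forall i, degree K i = #|[set j | G (f i) (f j)]|) ->
  exists2 G' : sgraph T, forall x, degree G' x = degree G x &
    forall i j, G' (f i) (f j) = K i j.
Proof.
move=> f_inj Kdeg.
pose r x y := match [pick i | f i == x], [pick j | f j == y] with
  | Some i, Some j => K i j | _, _ => G x y end.
have pickf i : [pick j | f j == f i] = Some i.
  by case: pickP => [j /eqP/f_inj->|/(_ i)]; rewrite ?eqxx.
have r_sym : symmetric r.
  by move=> x y; rewrite /r; case: pickP => [i _|_]; case: pickP => [j _|_] //;
    apply: edge_sym.
have r_irr : irreflexive r.
  by move=> x; rewrite /r; case: pickP => [i _|_]; apply: edge_irr.
exists (SGraph r_sym r_irr) => [x|i j]; last by rewrite /= /r !pickf.
have rG y : y \notin f @: setT -> r x y = G x y.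
  move=> yf; rewrite /r; case: pickP => // i _; case: pickP => // j /eqP fj.
  by rewrite -fj imset_f in yf.
have [/imsetP[i _ ->]|xf] := boolP (x \in f @: setT); last first.
  apply: eq_card => y; rewrite !inE /= /r; case: pickP => // i /eqP fi.
  by rewrite -fi imset_f in xf.
rewrite /degree -(cardsID (f @: setT)) -[RHS](cardsID (f @: setT)).
congr (_ + _).
  have -> : [set w | G (f i) w] :&: f @: setT = f @: [set j | G (f i) (f j)].
    apply/setP => w; rewrite !inE; apply/andP/imsetP => [[Gw /imsetP[j _ wE]]|].
      by exists j => //; rewrite inE -wE.
    by case=> j; rewrite inE => Gj ->; rewrite imset_f.
  rewrite card_imset // -Kdeg.
  have -> : [set w | r (f i) w] :&: f @: setT = f @: [set j | K i j].
    apply/setP => w; rewrite !inE; apply/andP/imsetP => [[Gw /imsetP[j _ wE]]|].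
      by exists j => //; rewrite inE; move: Gw; rewrite wE /r !pickf.
    by case=> j; rewrite inE => Kj ->; rewrite imset_f // /r !pickf.
  by rewrite card_imset.
apply: eq_card => y; rewrite !inE; case: (boolP (y \in _)) => //= yf.
rewrite /r pickf; case: pickP => // j /eqP fj.
by rewrite -fj imset_f in yf.
Qed.

(* The six-vertex graphs in which 0, .., 5 is a (3,3)-blossom in this order: [a]
   says whether the sequence of pairs starts with an edge, and [x] lists the
   eight unrestricted pairs. *)
Definition blossom_rows (a : bool) (x : bitseq) : seq bitseq :=
  [:: [::]; [:: a]; [:: a; ~~ a]; [:: ~~ a; nth false x 0; nth false x 1];
      [:: nth false x 2; nth false x 3; nth false x 4; a];
      [:: nth false x 5; nth false x 6; nth false x 7; a; ~~ a]].

Definition row_degrees (l : seq bitseq) : seq nat :=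
  [seq count (adj l i) (iota 0 6) | i <- iota 0 6].

Lemma calB_degrees_blossom :
  all (fun l => has (fun a => has (fun x =>
    sort geq (row_degrees (blossom_rows a x)) == l) (bitseqs 8)) [:: true; false])
    calB_degrees.
Proof. by lazy. Qed.

(** The search provides a blossom graph with the same sorted degrees as [H]; the permutation [p]
    matches vertices of equal degree. *)
Lemma calB_blossom (H : sgraph 'I_6) : calB H ->
  exists (K : sgraph 'I_6) (p : 'I_6 -> 'I_6),
    [/\ injective p, forall i, degree K i = degree H (p i) & has_blossom33 K].
Proof.
rewrite /calB => /(allP calB_degrees_blossom)/hasP[a _ /hasP[x _ /eqP KH]].
have K_sym : symmetric (fun i j : 'I_6 => adj (blossom_rows a x) i j).
  by move=> i j; rewrite /adj orbC.
have K_irr : irreflexive (fun i j : 'I_6 => adj (blossom_rows a x) i j).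
  by do 8?[case=> //].
pose K := SGraph K_sym K_irr; exists K.
have Kdeg : row_degrees (blossom_rows a x) = [seq degree K i | i : 'I_6].
  rewrite /row_degrees -(val_enum_ord 6) -map_comp /image_mem.
  apply: eq_map => v; rewrite /= count_map /degree cardsE cardE.
  by rewrite enumT size_filter; apply: eq_count.
have /(@tuple_permP _ 6 _ [tuple degree H i | i < 6])[p pE] :
    perm_eq [seq degree K i | i : 'I_6] [tuple degree H i | i < 6].
  by rewrite -Kdeg -(perm_sort geq) KH perm_sort.
exists p; split; first exact: perm_inj.
  move=> i; have := congr1 (fun s => nth 0 s i) pE.
  rewrite /image_mem (nth_map i) ?size_enum_ord // nth_ord_enum => ->.
  by rewrite -tnth_nth !tnth_mktuple.
pose o k (k6 : k < 6) := Ordinal k6.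
exists (o 0 isT), (o 1 isT), (o 2 isT), (o 3 isT), (o 4 isT), (o 5 isT).
split; first by [].
by split; [| | |split]; rewrite /= /adj /=; case: (a).
Qed.

Lemma blossom_of_calB (T : finType) (G : sgraph T) (A : {set T})
    (H : sgraph 'I_6) :
  calB H -> graph_iso (induced G A) H ->
  exists2 G' : sgraph T, forall x, degree G' x = degree G x & has_blossom33 G'.
Proof.
move=> /calB_blossom[K [p [p_inj KH Kblossom]]] /induced_embeds[f [f_inj _ fH]].
have fp_inj : injective (f \o p) by apply: inj_comp.
suff h : forall i, degree K i = #|[set j | G ((f \o p) i) ((f \o p) j)]|.
  have [G' G'deg G'K] := degree_preserving_replace fp_inj h.
  exists G' => //; case: Kblossom => v1 [v2 [v3 [w1 [w2 [w3 [vw_uniq]]]]]].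
  rewrite -!G'K => B.
  exists (f (p v1)), (f (p v2)), (f (p v3)), (f (p w1)), (f (p w2)), (f (p w3)).
  by split=> //; rewrite -(map_inj_uniq fp_inj) in vw_uniq.
move=> i; rewrite KH -(card_imset _ p_inj); apply: eq_card => w.
rewrite !inE; apply/idP/imsetP => [Hw|].
  have [q pq qp] := injF_bij p_inj.
  by exists (q w); rewrite ?qp // inE /= fH qp.
by case=> j; rewrite inE /= fH => ? ->.
Qed.

Import Order.TTheory GRing.Theory Num.Theory.
Local Open Scope ring_scope.

(** * Edge-indexed vectors as symmetric matrices *)

Lemma vpairP (n : nat) (e : vpair n) :
  exists i j, i != j /\ val e = [set i; j].
Proof. by apply/cards2P; apply: (valP e). Qed.

Lemma vpair_ex (n : nat) (i j : 'I_n) :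
  i != j -> exists e : vpair n, val e = [set i; j].
Proof.
move=> ij; have e2 : #|[set i; j]| == 2%N by rewrite cards2 ij.
by exists (exist _ [set i; j] e2).
Qed.

Lemma set2_eq (T : finType) (i j k l : T) :
  [set i; j] = [set k; l] -> (i = k /\ j = l) \/ (i = l /\ j = k).
Proof.
move=> ijkl; have : k \in [set i; j] by rewrite ijkl set21.
have : l \in [set i; j] by rewrite ijkl set22.
have : i \in [set k; l] by rewrite -ijkl set21.
have : j \in [set k; l] by rewrite -ijkl set22.
rewrite !inE => /orP[]/eqP-> /orP[]/eqP-> /orP[]/eqP + /orP[]/eqP; auto.
Qed.

(** The symmetric matrix of an edge-indexed vector. The sum has a single term off the diagonal and
    is empty on it, so row sums can range over all vertices. *)
Definition weight (R : realType) (n : nat) (x : {ffun vpair n -> R^o})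
    (i j : 'I_n) : R :=
  \sum_(e : vpair n | val e == [set i; j]) x e.

Section Weight.
Variables (R : realType) (n : nat).
Implicit Types (x y z : {ffun vpair n -> R^o}) (i j : 'I_n) (e : vpair n).

Lemma weight_sym x i j : weight x i j = weight x j i.
Proof. by rewrite /weight setUC. Qed.

Lemma weight_diag x i : weight x i i = 0.
Proof.
rewrite /weight big_pred0 // => e; apply/negP => /eqP ei.
by have := valP e; rewrite ei setUid cards1.
Qed.

Lemma weightE x e i j : val e = [set i; j] -> weight x i j = x e.
Proof.
by move=> eij; rewrite /weight (big_pred1 e) // => e'; rewrite -eij (inj_eq val_inj).
Qed.

Lemma sum_weight x j :
  \sum_(e : vpair n | j \in val e) x e = \sum_i weight x j i.
Proof.
rewrite /weight (exchange_big_dep (fun e => j \in val e)) /=; last first.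
  by move=> i e _ /eqP->; rewrite set21.
apply: eq_bigr => e je.
have [i [k [ik eik]]] := vpairP e.
have {ik eik i k je} [i ji eji] : exists2 i, j != i & val e = [set j; i].
  move: je; rewrite eik in_set2 => /orP[]/eqP->; first by exists k.
  by exists i; rewrite 1?eq_sym // setUC.
rewrite (big_pred1 i) // => k; rewrite eji; apply/eqP/eqP => [|->//].
by move=> /set2_eq[[]|[-> ]] // ->.
Qed.

Lemma polytopeP (d : n.-tuple nat) x :
  polytope d x <->
  (forall j, \sum_i weight x j i = (tnth d j)%:R) /\
  (forall i j, 0 <= weight x i j <= 1).
Proof.
split=> [[xd x01]|[xd x01]]; split=> [j|].
- by rewrite -sum_weight xd.
- move=> i j; have [->|ij] := eqVneq i j; first by rewrite weight_diag lexx ler01.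
  by have [e /(weightE x)->] := vpair_ex ij.
- by rewrite sum_weight xd.
- by move=> e; have [i [j [_ /(weightE x)<-]]] := vpairP e.
Qed.

(** Inverse of [weight] on symmetric matrices with zero diagonal; symmetry makes the choice of an
    ordering of each pair harmless. *)
Definition of_weight (u : 'I_n -> 'I_n -> R) : {ffun vpair n -> R^o} :=
  [ffun e => if [pick p | val e == [set p.1; p.2]] is Some p
             then u p.1 p.2 else 0].

Lemma of_weightK (u : 'I_n -> 'I_n -> R) i j :
  (forall i j, u i j = u j i) -> (forall i, u i i = 0) ->
  weight (of_weight u) i j = u i j.
Proof.
move=> u_sym u0; have [->|ij] := eqVneq i j; first by rewrite weight_diag u0.
have [e eij] := vpair_ex ij; rewrite (weightE _ eij) ffunE.
case: pickP => [[k l] /eqP/=|/(_ (i, j))]; last by rewrite eij eqxx.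
by rewrite eij => /set2_eq[[-> ->]|[-> ->]].
Qed.

Lemma weight_inj x y : (forall i j, weight x i j = weight y i j) -> x = y.
Proof.
move=> xy; apply/ffunP => e; have [i [j [_ eij]]] := vpairP e.
by rewrite -(weightE x eij) -(weightE y eij).
Qed.

Lemma weight_convex y z t i j :
  weight (t *: y + (1 - t) *: z) i j = t * weight y i j + (1 - t) * weight z i j.
Proof.
rewrite /weight !mulr_sumr -big_split; apply: eq_bigr => e _.
by rewrite !ffunE.
Qed.

End Weight.

(** * A blossom yields a fractional extreme point *)

Lemma convex_01 (R : realType) (t y z x : R) :
  0 < t < 1 -> 0 <= y <= 1 -> 0 <= z <= 1 -> x = t * y + (1 - t) * z ->
  x = 0 \/ x = 1 -> y = x.
Proof.
move=> /andP[t0 t1] /andP[y0 y1] /andP[z0 z1] xE [x0|x1].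
  have ty : t * y = 0.
    have := mulr_ge0 (ltW t0) y0.
    have := mulr_ge0 (_ : 0 <= 1 - t) z0; rewrite subr_ge0 ltW // => /(_ isT).
    by lra.
  by move/eqP: ty; rewrite mulf_eq0 gt_eqF //= => /eqP->; rewrite x0.
have ty : t * (1 - y) = 0.
  have := mulr_ge0 (ltW t0) (_ : 0 <= 1 - y); rewrite subr_ge0 y1 => /(_ isT).
  have := mulr_ge0 (_ : 0 <= 1 - t) (_ : 0 <= 1 - z).
  by rewrite !subr_ge0 (ltW t1) z1 => /(_ isT isT); lra.
by move/eqP: ty; rewrite mulf_eq0 gt_eqF //= subr_eq0 => /eqP<-; rewrite x1.
Qed.

Lemma sum_nat_degree (R : realType) (T : finType) (G : sgraph T) v :
  \sum_w (G v w)%:R = (degree G v)%:R :> R.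
Proof.
rewrite /degree -sum1_card natr_sum [RHS]big_mkcond /=.
by apply: eq_bigr => w _; rewrite inE; case: (G v w).
Qed.

Lemma sum_support_seq (V : zmodType) (T : finType) (s : seq T) (F : T -> V) :
  uniq s -> (forall i, i \notin s -> F i = 0) ->
  \sum_i F i = \sum_(i <- s) F i.
Proof.
move=> s_uniq F0; rewrite [RHS]big_uniq //= [LHS](bigID (mem s)) /=.
by rewrite [X in _ + X]big1 ?addr0.
Qed.

(* Rows and columns are indexed by [:: v1; v2; v3; w1; w2; w3]; entries are
   twice the changes made along the blossom, up to a global sign. *)
Definition blossom_shift : seq (seq int) :=
  [:: [:: 0; -1; -1;  2;  0;  0];
      [:: -1; 0;  1;  0;  0;  0];
      [:: -1; 1;  0;  0;  0;  0];
      [:: 2;  0;  0;  0; -1; -1];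
      [:: 0;  0;  0; -1;  0;  1];
      [:: 0;  0;  0; -1;  1;  0]].

Definition shift (R : realType) (k l : nat) : R :=
  (nth 0 (nth [::] blossom_shift k) l)%:~R / 2.

Definition in_triangle (k l : nat) : bool :=
  [&& (k < 6)%N, (l < 6)%N, k != l & (k < 3)%N == (l < 3)%N].

Lemma shift_sym (R : realType) k l : shift R k l = shift R l k.
Proof.
rewrite /shift; congr (_%:~R / 2).
by do 7?[case: k => [|k]]; do 7?[case: l => [|l]]; rewrite /= ?nth_nil.
Qed.

(** The shift is added as it stands when the first pair is an edge and negated otherwise. Either way
    the triangle pairs move from 0 or 1 to 1/2, and the pair joining positions 0 and 3 is
    flipped. *)
Lemma alternating_shift (R : realType) (g : nat -> nat -> bool) (a : bool) :
  symmetric g ->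
  [/\ g 0 1 = a, g 1 2 = ~~ a, g 2 0 = a, g 0 3 = ~~ a &
      [/\ g 3 4 = a, g 4 5 = ~~ a & g 5 3 = a]]%N ->
  let val k l := (g k l)%:R + (if a then 1 else -1) * shift R k l in
  (forall k l, in_triangle k l -> val k l = 1 / 2) /\
  (forall k l, ~~ in_triangle k l -> val k l = 0 \/ val k l = 1).
Proof.
move=> gsym [g01 g12 g20 g03 [g34 g45 g53]] val.
have {gsym} gE := (g01, g12, g20, g03, g34, g45, g53, gsym 1%N 0%N, gsym 2%N 1%N,
  gsym 0%N 2%N, gsym 3%N 0%N, gsym 4%N 3%N, gsym 5%N 4%N, gsym 3%N 5%N).
split=> k l.
  rewrite /val /shift /in_triangle.
  by case: k l => [|[|[|[|[|[|k]]]]]] [|[|[|[|[|[|l]]]]]] //= _;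
    rewrite !gE; case: (a) => /=; lra.
have shift0 : shift R k l = 0 -> val k l = 0 \/ val k l = 1.
  by rewrite /val => ->; rewrite mulr0 addr0; case: (g k l); [right|left].
move=> tri.
have [/shift0//|h] : shift R k l = 0 \/ (k, l) \in [:: (0, 3); (3, 0)]%N.
  move: tri; rewrite /in_triangle /shift {shift0}.
  by do 7?[case: k => [|k]]; do 7?[case: l => [|l]] => //= _;
    rewrite ?nth_nil ?mul0r; by [left|right].
move: h; rewrite !inE !xpair_eqE => /orP[]/andP[/eqP-> /eqP->];
rewrite /val /shift /= !gE; case: (a) => /=; by [left; lra|right; lra].
Qed.

Lemma blossom_not_decisive (R : realType) (n : nat) (d : n.-tuple nat)
    (G : sgraph 'I_n) :
  realization d G -> has_blossom33 G -> ~ decisive R d.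
Proof.
move=> Gd [v1 [v2 [v3 [w1 [w2 [w3 [s_uniq]]]]]]].
set s := [:: v1; v2; v3; w1; w2; w3] in s_uniq *.
pose g k l := G (nth v1 s k) (nth v1 s l).
rewrite -[G v1 v2]/(g 0 1)%N -[G v2 v3]/(g 1 2)%N -[G v3 v1]/(g 2 0)%N.
rewrite -[G v1 w1]/(g 0 3)%N -[G w1 w2]/(g 3 4)%N -[G w2 w3]/(g 4 5)%N.
rewrite -[G w3 w1]/(g 5 3)%N => alt.
have Gsym := edge_sym G.
have gsym : symmetric g by move=> k l; apply: Gsym.
have [|val_tri val_int] := @alternating_shift R g (g 0 1)%N gsym.
  by case: alt; case: (g 0 1)%N (g 1 2)%N (g 2 0)%N (g 0 3)%N (g 3 4)%N (g 4 5)%N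
    (g 5 3)%N => [] [] [] [] [] [] [] // _ _ _ [].
set a := g 0%N 1%N in alt val_tri val_int.
(* Vertices off the blossom get index 6, where the entries of [shift] default to 0. *)
pose ix i := index i s.
have ixK i : (ix i < 6)%N -> nth v1 s (ix i) = i.
  by move=> i6; apply: nth_index; rewrite -index_mem.
pose u i j : R := (G i j)%:R + (if a then 1 else -1) * shift R (ix i) (ix j).
have shift_out k l : (5 < k)%N -> shift R k l = 0.
  by move=> k6; rewrite /shift [nth [::] _ _]nth_default // nth_nil mul0r.
have u_tri i j : in_triangle (ix i) (ix j) -> u i j = 1 / 2.
  move=> tri; have /and4P[i6 j6 _ _] := tri.
  by rewrite -(val_tri _ _ tri) /val /g !ixK.
have u_int i j : ~~ in_triangle (ix i) (ix j) -> u i j = 0 \/ u i j = 1.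
  have u_out : shift R (ix i) (ix j) = 0 -> u i j = 0 \/ u i j = 1.
    rewrite /u => ->; rewrite mulr0 addr0.
    by case: (G i j); [right|left].
  move=> tri; have [i6|i6] := ltnP (ix i) 6; last by apply: u_out; apply: shift_out.
  have [j6|j6] := ltnP (ix j) 6.
    by have := val_int _ _ tri; rewrite /val /g !ixK.
  by apply: u_out; rewrite shift_sym shift_out.
have u_sym i j : u i j = u j i by rewrite /u Gsym shift_sym.
have u0 i : u i i = 0.
  rewrite /u edge_irr add0r; have [i6|i6] := ltnP (ix i) 6.
    by move: (ix i) i6; do 6?[case=> [|//]]; rewrite /shift /= mul0r mulr0.
  by rewrite shift_out ?mulr0.
pose x := of_weight u.
have xE i j : weight x i j = u i j by apply: of_weightK.
have sum_s (F : 'I_n -> R) : (forall j, j \notin s -> F j = 0) ->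
    \sum_j F j = F v1 + (F v2 + (F v3 + (F w1 + (F w2 + F w3)))).
  by move=> /(sum_support_seq s_uniq)->; rewrite !big_cons big_nil addr0.
have [iv1 iv2 iv3 [iw1 iw2 iw3]] : [/\ ix v1 = 0, ix v2 = 1, ix v3 = 2 &
    [/\ ix w1 = 3, ix w2 = 4 & ix w3 = 5]]%N.
  by split; last split; [apply: (index_uniq v1 (_ : 0 < size s)%N s_uniq)
    | apply: (index_uniq v1 (_ : 1 < size s)%N s_uniq)
    | apply: (index_uniq v1 (_ : 2 < size s)%N s_uniq)
    | apply: (index_uniq v1 (_ : 3 < size s)%N s_uniq)
    | apply: (index_uniq v1 (_ : 4 < size s)%N s_uniq)
    | apply: (index_uniq v1 (_ : 5 < size s)%N s_uniq)].
have ixE := (iv1, iv2, iv3, iw1, iw2, iw3).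
have ix_out j : j \notin s -> (5 < ix j)%N.
  by rewrite -index_mem -leqNgt.
have Px : polytope d x.
  apply/polytopeP; split=> [j|i j]; last first.
    rewrite xE; case: (boolP (in_triangle (ix i) (ix j))) => [/u_tri->|/u_int[]->].
    - by lra.
    - by rewrite lexx ler01.
    - by rewrite ler01 lexx.
  under eq_bigr do rewrite xE; rewrite /u big_split /= sum_nat_degree Gd.
  rewrite -mulr_sumr sum_s ?ixE => [|i /ix_out i6].
    suff -> : shift R (ix j) 0 + (shift R (ix j) 1 + (shift R (ix j) 2 +
        (shift R (ix j) 3 + (shift R (ix j) 4 + shift R (ix j) 5)))) = 0.
      by rewrite mulr0 addr0.
    have [j6|j6] := ltnP (ix j) 6; last by rewrite !shift_out // !addr0.
    by move: (ix j) j6; do 6?[case=> [|//]]; rewrite /shift /=; lra.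
  by rewrite shift_sym shift_out.
have extr y z t : polytope d y -> polytope d z -> 0 < t < 1 ->
    x = t *: y + (1 - t) *: z -> y = x.
  move=> /polytopeP[yd y01] /polytopeP[zd z01] t01 xyz.
  pose h i j := weight y i j - weight x i j.
  have h_int i j : ~~ in_triangle (ix i) (ix j) -> h i j = 0.
    move=> /u_int; rewrite -xE => w01; apply/eqP; rewrite subr_eq0; apply/eqP.
    by apply: (convex_01 t01 (y01 i j) (z01 i j) _ w01); rewrite {1}xyz weight_convex.
  have h_sym i j : h i j = h j i by rewrite /h !(weight_sym _ i).
  have h_sum i : h i v1 + (h i v2 + (h i v3 + (h i w1 + (h i w2 + h i w3)))) = 0.
    have /polytopeP[xd _] := Px.
    rewrite -(sum_s (h i)) ?sumrB ?yd ?xd ?subrr // => j /ix_out j6.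
    by apply: h_int; apply/negP => /and4P[_]; rewrite ltnNge j6.
  (* On each triangle the two entries of [h] at a vertex cancel; going round three edges, each entry
     equals its own opposite. *)
  have h_tri : [/\ h v1 v2 = 0, h v2 v3 = 0, h v3 v1 = 0 &
      [/\ h w1 w2 = 0, h w2 w3 = 0 & h w3 w1 = 0]].
    have := (h_sum v1, h_sum v2, h_sum v3, h_sum w1, h_sum w2, h_sum w3).
    rewrite (h_int v1 v1) ?(h_int v1 w1) ?(h_int v1 w2) ?(h_int v1 w3) ?ixE //.
    rewrite (h_int v2 v2) ?(h_int v2 w1) ?(h_int v2 w2) ?(h_int v2 w3) ?ixE //.
    rewrite (h_int v3 v3) ?(h_int v3 w1) ?(h_int v3 w2) ?(h_int v3 w3) ?ixE //.
    rewrite (h_int w1 w1) ?(h_int w1 v1) ?(h_int w1 v2) ?(h_int w1 v3) ?ixE //.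
    rewrite (h_int w2 w2) ?(h_int w2 v1) ?(h_int w2 v2) ?(h_int w2 v3) ?ixE //.
    rewrite (h_int w3 w3) ?(h_int w3 v1) ?(h_int w3 v2) ?(h_int w3 v3) ?ixE //.
    rewrite (h_sym v2 v1) (h_sym v3 v2) (h_sym v1 v3).
    rewrite (h_sym w2 w1) (h_sym w3 w2) (h_sym w1 w3).
    move: (h v1 v2) (h v2 v3) (h v3 v1) (h w1 w2) (h w2 w3) (h w3 w1).
    by move=> ? ? ? ? ? ? [[[[[? ?] ?] ?] ?] ?]; split; last split; lra.
  apply: weight_inj => i j; apply/eqP; rewrite -subr_eq0; apply/eqP.
  rewrite -/(h i j); have [tri|] := boolP (in_triangle (ix i) (ix j)); last exact: h_int.
  have /and4P[i6 j6 _ _] := tri.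
  case: h_tri => h1 h2 h3 [h4 h5 h6]; rewrite -(ixK i) // -(ixK j) //.
  move: (ix i) (ix j) tri {i6 j6} => k l.
  case: k l => [|[|[|[|[|[|k]]]]]] [|[|[|[|[|[|l]]]]]] //= _;
  by [rewrite h_sym|].
have v12 : v1 != v2 by move: s_uniq; rewrite /= inE negb_or => /andP[/andP[]].
move=> dec; have [e ev] := vpair_ex v12.
have : weight x v1 v2 = 1 / 2 by rewrite xE u_tri ?ixE.
rewrite (weightE _ ev) => xe.
have Ex : extreme_point (polytope d) x.
  split=> // y z t Py Pz t01 xyz; split; first exact: extr xyz.
  apply: (extr z y (1 - t)) => //; first by case/andP: t01 => ? ?; lra.
  by rewrite xyz addrC; congr (_ + _ *: _); lra.
by case: (dec x Ex e) => xe'; move: xe; rewrite xe'; lra.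
Qed.

(** * Fractional extreme points *)

(** Each condition is required on a whole interval above 0, so that it survives taking the minimum
    of finitely many radii. *)
Lemma common_radius (R : realType) (I : finType) (P : I -> R -> Prop) :
  (forall i, exists2 r, 0 < r & forall t, 0 < t <= r -> P i t) ->
  exists2 r, 0 < r & forall i, P i r.
Proof.
move=> Pr; suff [r r0 rP] : exists2 r : R, 0 < r &
    forall t, 0 < t <= r -> forall i, i \in enum I -> P i t.
  by exists r => // i; apply: rP; rewrite ?r0 ?lexx ?mem_enum.
elim: (enum I) => [|i s [r r0 rP]]; first by exists 1.
have [r' r'0 r'P] := Pr i; exists (Num.min r r'); first by rewrite lt_min r0.
move=> t /andP[t0]; rewrite le_min => /andP[tr tr'] j.
rewrite inE => /orP[/eqP->|]; first by apply: r'P; rewrite t0.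
by apply: rP; rewrite t0.
Qed.

(** A nonzero [z] supported on the fractional pairs would make [x] the midpoint of [x + r z] and
    [x - r z], both in the polytope for small [r]. *)
Lemma extreme_rigid (R : realType) (n : nat) (d : n.-tuple nat)
    (x z : {ffun vpair n -> R^o}) :
  extreme_point (polytope d) x ->
  (forall e, x e = 0 \/ x e = 1 -> z e = 0) ->
  (forall j : 'I_n, \sum_(e : vpair n | j \in val e) z e = 0) -> z = 0.
Proof.
move=> [[xd x01] xext] z0 zd.
have [r r0 rP] : exists2 r : R, 0 < r &
    forall e, 0 <= x e + r * z e <= 1 /\ 0 <= x e - r * z e <= 1.
  apply: (@common_radius R _ (fun e r =>
    0 <= x e + r * z e <= 1 /\ 0 <= x e - r * z e <= 1)) => e.
  have [xe|xe] := boolP ((x e == 0) || (x e == 1)).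
    exists 1 => // t _; rewrite z0 ?mulr0 ?addr0 ?subr0 ?x01 //.
    by case/orP: xe => /eqP; [left|right].
  have [x0 x1] : 0 < x e /\ x e < 1.
    move: xe (x01 e); rewrite negb_or => /andP[n0 n1] /andP[h0 h1].
    by rewrite !lt_neqAle h0 h1 eq_sym n0 n1.
  pose m := Num.min (x e) (1 - x e).
  have m0 : 0 < m by rewrite lt_min x0 subr_gt0.
  have mx : m <= x e by rewrite ge_min lexx.
  have m1 : m <= 1 - x e by rewrite ge_min lexx orbT.
  have Z : 0 < 1 + `|z e| by rewrite ltr_pwDl.
  (* The summand 1 keeps the quotient defined when [z e] is zero. *)
  exists (m / (1 + `|z e|)) => [|t /andP[t0]]; first exact: divr_gt0.
  rewrite ler_pdivlMr // mulrDr mulr1 => tm.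
  have : `|t * z e| <= m by rewrite normrM gtr0_norm //; lra.
  by rewrite ler_norml => /andP[]; lra.
have Pz (b : R) : b = 1 \/ b = -1 -> polytope d (x + (b * r) *: z).
  move=> b1; split=> [j|e].
    under eq_bigr do rewrite !ffunE.
    by rewrite big_split /= xd -mulr_sumr zd mulr0 addr0.
  rewrite !ffunE; have [rp rm] := rP e.
  by case: b1 => ->; rewrite ?mul1r // mulN1r scaleNr.
have [] := xext _ _ (1 / 2) (Pz 1 (or_introl erefl)) (Pz (-1) (or_intror erefl)).
- by lra.
- by apply/ffunP => e; rewrite !ffunE /GRing.scale /=; lra.
move=> xz _; apply/ffunP => e; move/ffunP/(_ e): xz.
rewrite !ffunE mul1r => /eqP; rewrite -subr_eq0 addrC addKr.
by rewrite mulf_eq0 gt_eqF // => /eqP.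
Qed.

Definition touched (T : finType) (F : rel T) : {set T} :=
  [set i | [exists j, F i j]].

(* The combinatorial shadow of a fractional extreme point: [F] holds the pairs
   of value 1/2 and [O] those of value 1.  [half_rank] says that every connected
   component of [F] contains an odd cycle. *)
Record half_integral (T : finType) (dd : T -> nat) (F O : rel T) : Prop :=
  HalfIntegral {
    half_symF : symmetric F;
    half_symO : symmetric O;
    half_irrF : irreflexive F;
    half_irrO : irreflexive O;
    half_disj : forall i j, F i j -> O i j = false;
    half_reg : forall i, i \in touched F -> #|[set j | F i j]| = 2%N;
    half_deg : forall i, dd i = (#|[set j | O i j]| + (i \in touched F))%N;
    half_even : ~~ odd #|touched F|;
    half_rank : forall s : T -> int, (forall i j, F i j -> s i + s j = 0) ->
      forall i, i \in touched F -> s i = 0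
  }.

Lemma handshake (n : nat) (r : rel 'I_n) :
  symmetric r -> irreflexive r -> ~~ odd (\sum_i #|[set j | r i j]|)%N.
Proof.
move=> r_sym r_irr.
have -> : (\sum_i #|[set j | r i j]| = \sum_i \sum_j (r i j : nat))%N.
  apply: eq_bigr => i _; rewrite -sum1_card big_mkcond /=.
  by apply: eq_bigr => j _; rewrite inE; case: (r i j).
have -> : (\sum_i \sum_j (r i j : nat) =
    \sum_(i < n) \sum_(j < n) ((i < j) && r i j) +
    \sum_(i < n) \sum_(j < n) ((j < i) && r i j))%N.
  rewrite -big_split; apply: eq_bigr => i _; rewrite -big_split.
  apply: eq_bigr => j _ /=; case: ltngtP => //= [|ij]; first by rewrite addn0.
  by rewrite (val_inj ij) r_irr.
rewrite [X in (_ + X)%N]exchange_big /= oddD.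
under [X in odd _ (+) odd X]eq_bigr do under eq_bigr do rewrite r_sym.
by rewrite addbb.
Qed.

Section Extreme.
Variables (R : realType) (n : nat) (d : n.-tuple nat).
Variable x : {ffun vpair n -> R^o}.
Hypothesis x_ext : extreme_point (polytope d) x.

Let w := weight x.
Let F : rel 'I_n := fun i j => (w i j != 0) && (w i j != 1).
Let O : rel 'I_n := fun i j => w i j == 1.
Let S := touched F.
Let Fe := [set e | (x e != 0) && (x e != 1)].

Lemma extreme_weight01 i j : 0 <= w i j <= 1.
Proof. by have [/polytopeP[_]] := x_ext. Qed.

Lemma extreme_F_sym : symmetric F.
Proof. by move=> i j; rewrite /F /w weight_sym. Qed.

Lemma extreme_F_frac i j : F i j -> 0 < w i j < 1.
Proof.
case/andP=> n0 n1; have /andP[w0 w1] := extreme_weight01 i j.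
by rewrite !lt_neqAle w0 w1 eq_sym n0 n1.
Qed.

Lemma extreme_fractional_sum i :
  (tnth d i)%:R = #|[set j | O i j]|%:R + \sum_(j | F i j) w i j.
Proof.
have [/polytopeP[xd _] _] := x_ext.
rewrite -xd (bigID (F i)) /= addrC; congr (_ + _).
rewrite -sum1_card natr_sum big_mkcond [RHS]big_mkcond /=.
apply: eq_bigr => j _; rewrite inE /F /O -/w negb_and !negbK.
by case: (eqVneq (w i j) 1) => [->|]; rewrite ?orbT // orbF => _; case: eqP.
Qed.

(** Row sums are integers, so a row cannot contain exactly one fractional entry. *)
Lemma extreme_two_fractional i : i \in S -> (2 <= #|[set j | F i j]|)%N.
Proof.
rewrite inE => /existsP[j Fij]; rewrite ltnNge; apply/negP => F1.
have := extreme_fractional_sum i; rewrite (bigD1 j) //= big1 => [|k /andP[Fik kj]].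
  rewrite addr0 => wE; have /andP[w0 w1] := extreme_F_frac Fij.
  have : (#|[set j | O i j]|%:R < (tnth d i)%:R :> R) by rewrite wE; lra.
  have : ((tnth d i)%:R < #|[set j | O i j]|.+1%:R :> R) by rewrite wE -natr1; lra.
  by rewrite !ltr_nat ltnS => /leq_ltn_trans/[apply]; rewrite ltnn.
have : (#|[set j; k]| <= #|[set j | F i j]|)%N.
  by apply: subset_leq_card; apply/subsetP => l; rewrite !inE => /orP[]/eqP->.
by rewrite cards2 eq_sym kj => /leq_trans/(_ F1).
Qed.

Lemma weight_Fe i j :
  weight [ffun e => (e \in Fe)%:R : R^o] i j = (F i j)%:R.
Proof.
have [->|ij] := eqVneq i j.
  by rewrite weight_diag /F /w weight_diag eqxx.
have [e eij] := vpair_ex ij.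
by rewrite (weightE _ eij) ffunE inE /F /w (weightE x eij).
Qed.

(** Both sides are row sums of the indicator of the fractional pairs, read through [sum_weight]. *)
Lemma card_Fe i : #|[set e in Fe | i \in val e]| = #|[set j | F i j]|.
Proof.
apply/eqP; rewrite -(eqr_nat R) -[X in X%:R == _]sum1_card natr_sum.
have := sum_weight [ffun e => (e \in Fe)%:R : R^o] i.
under [X in _ = X]eq_bigr do rewrite weight_Fe.
rewrite -[X in _ == X%:R]sum1_card natr_sum big_mkcond /= => h.
rewrite [X in _ == X]big_mkcond /=.
under [X in _ == X]eq_bigr do rewrite inE.
rewrite (eq_bigr (fun j => (F i j)%:R)) => [|j _]; last by case: (F i j).
rewrite -h [X in X == _]big_mkcond /=; apply/eqP/eq_bigr => e _.
by rewrite !inE ffunE inE; case: (i \in val e); case: ((_ != _) && _).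
Qed.

Lemma sum_card_Fe : (\sum_(i in S) #|[set j | F i j]| = #|Fe| * 2)%N.
Proof.
transitivity (\sum_i #|[set e in Fe | i \in val e]|)%N.
  rewrite [RHS](bigID (mem S)) /= [X in _ = (_ + X)%N]big1 ?addn0.
    by apply: eq_bigr => i _; rewrite card_Fe.
  move=> i; rewrite card_Fe inE negb_exists => /forallP iF.
  by apply: eq_card0 => j; rewrite inE (negbTE (iF j)).
under eq_bigr do rewrite -sum1_card.
rewrite (exchange_big_dep (mem Fe)) /= => [|i e _]; last by rewrite inE => /andP[].
rewrite -sum_nat_const; apply: eq_bigr => e eF.
transitivity #|val e|; last exact: (eqP (valP e)).
by rewrite -sum1_card; apply: eq_bigl => i; rewrite inE eF.
Qed.

Let m := #|Fe|.
Let k := #|S|.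
Let M : 'M[R]_(m, k) :=
  \matrix_(p, q) (enum_val q \in val (enum_val p : vpair n))%:R.

(** A vector in the left kernel is a weighting of the fractional pairs with zero sum at every
    vertex, which [extreme_rigid] kills. *)
Lemma extreme_row_free : row_free M.
Proof.
rewrite -kermx_eq0; apply/rowV0P => y /sub_kermxP yM.
pose z : {ffun vpair n -> R^o} :=
  [ffun e => \sum_(p < m | enum_val p == e) y 0 p].
have zE p : z (enum_val p) = y 0 p.
  by rewrite ffunE (big_pred1 p) // => q; rewrite (inj_eq enum_val_inj).
suff z0 : z = 0 by apply/rowP => p; rewrite -zE z0 ffunE mxE.
apply: (extreme_rigid x_ext) => [e x01|j].
  rewrite ffunE big_pred0 // => p; apply/negP => /eqP pe.
  have := enum_valP p; rewrite pe inE.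
  by case: x01 => ->; rewrite eqxx ?andbF.
have -> : \sum_(e : vpair n | j \in val e) z e =
    \sum_(p < m | j \in val (enum_val p : vpair n)) y 0 p.
  under eq_bigr do rewrite ffunE.
  rewrite (exchange_big_dep (fun p : 'I_m => j \in val (enum_val p : vpair n))) /=.
    apply: eq_bigr => p jp; rewrite (big_pred1 (enum_val p)) // => e /=.
    by case: (eqVneq (enum_val p) e) => [<-|_]; rewrite ?jp ?eqxx ?andbF.
  by move=> e p je /eqP->.
have [jS|jS] := boolP (j \in S); last first.
  rewrite big_pred0 // => p; apply: contraNF jS => jp.
  have := enum_valP p; rewrite inE.
  have [a [b [ab pab]]] := vpairP (enum_val p : vpair n).
  rewrite -(weightE x pab) -/w => Fab; rewrite inE.
  move: jp; rewrite pab in_set2 => /orP[]/eqP->; apply/existsP.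
    by exists b.
  by exists a; rewrite extreme_F_sym.
have := congr1 (fun N : 'rV_k => N 0 (enum_rank_in jS j)) yM.
rewrite !mxE => h; rewrite -[RHS]h big_mkcond /=; apply: eq_bigr => p _.
by rewrite mxE enum_rankK_in //; case: (j \in _); rewrite ?mulr1 ?mulr0.
Qed.

(** Independent rows give at most as many fractional pairs as touched vertices; at least two pairs
    at each touched vertex give the reverse inequality, and equality forces exactly two. *)
Lemma extreme_card : m = k /\ {in S, forall i, #|[set j | F i j]| = 2%N}.
Proof.
have mk : (m <= k)%N.
  by have /eqP <- := extreme_row_free; apply: rank_leq_col.
have deg2 : (\sum_(i in S) 2 <= \sum_(i in S) #|[set j | F i j]|
    ?= iff [forall (i | i \in S), 2 == #|[set j | F i j]|])%N.
  by apply: leqif_sum => i iS; split=> //; apply: extreme_two_fractional.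
have := deg2; rewrite sum_card_Fe sum_nat_const -/m -/k => -[].
rewrite leq_pmul2r // => km; have mkE : m = k by apply/eqP; rewrite eqn_leq mk.
by rewrite mkE eqxx => /esym/forall_inP h; split=> // i /h/eqP<-.
Qed.

Lemma extreme_half_integral (G : sgraph 'I_n) :
  realization d G -> half_integral (degree G) F O.
Proof.
move=> Gd; have [mk reg] := extreme_card.
(* Two numbers strictly between 0 and 1 add up to less than 2 and more than 0; with an integral row
   sum the total must be 1. *)
have deg i : degree G i = (#|[set j | O i j]| + (i \in S))%N.
  rewrite Gd; have := extreme_fractional_sum i.
  have [iS|iS] := boolP (i \in S); last first.
    rewrite big_pred0 ?addr0 ?addn0 => [/eqP|j]; first by rewrite eqr_nat => /eqP.
    by apply/negP => Fij; move: iS; rewrite inE; case/existsP; exists j.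
  have /eqP/cards2P[a [b [ab Fi]]] := reg i iS.
  have FE j : F i j = (j == a) || (j == b).
    by have /setP/(_ j) := Fi; rewrite !inE.
  rewrite (bigD1 a) ?FE ?eqxx //= (bigD1 b) ?FE ?eqxx ?orbT 1?eq_sym //=.
  rewrite big1 => [|j]; last first.
    by rewrite FE; case: (j == a); case: (j == b).
  have /andP[a0 a1] : 0 < w i a < 1 by apply: extreme_F_frac; rewrite FE eqxx.
  have /andP[b0 b1] : 0 < w i b < 1 by apply: extreme_F_frac; rewrite FE eqxx orbT.
  rewrite addr0 => dE.
  have : (#|[set j | O i j]|%:R < (tnth d i)%:R :> R) by rewrite dE; lra.
  have : ((tnth d i)%:R < #|[set j | O i j]|.+2%:R :> R).
    by rewrite dE -!natr1; lra.
  by rewrite !ltr_nat => ? ?; apply/eqP; rewrite eqn_leq addn1 -ltnS; apply/andP.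
have Osym : symmetric O by move=> i j; rewrite /O /w weight_sym.
have Oirr : irreflexive O.
  by move=> i; rewrite /O /w weight_diag eq_sym oner_eq0.
split=> //.
- exact: extreme_F_sym.
- by move=> i; rewrite /F /w weight_diag eqxx.
- by move=> i j /andP[_ /negbTE].
(* The degrees of [G] and of [O] both have even sums, and they differ by one exactly at the touched
   vertices. *)
- have := handshake (edge_sym G) (edge_irr G).
  rewrite (eq_bigr _ (fun i _ => deg i)) big_split /= oddD.
  rewrite (negbTE (handshake Osym Oirr)) /=.
  suff -> : #|touched F| = (\sum_i (i \in S : nat))%N by [].
  by rewrite -sum1_card big_mkcond; apply: eq_bigr => i _; case: (i \in _).
- move=> s sF.
  (* The incidence matrix is square, so its columns are independent too; the potential [s], read as
     a column, lies in the right kernel. *)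
  have full : row_full M by rewrite /row_full (eqP extreme_row_free) mk.
  pose c : 'cV[R]_k := \col_q (s (enum_val q))%:~R.
  have Mc : M *m c = M *m 0.
    rewrite mulmx0; apply/colP => p; rewrite !mxE.
    under eq_bigr do rewrite !mxE.
    have := enum_valP p; rewrite inE.
    have [a [b [ab pab]]] := vpairP (enum_val p : vpair n).
    rewrite -(weightE x pab) -/w => Fab.
    have aS : a \in S by rewrite inE; apply/existsP; exists b.
    have bS : b \in S by rewrite inE; apply/existsP; exists a; rewrite extreme_F_sym.
    rewrite (bigD1 (enum_rank_in aS a)) //= (bigD1 (enum_rank_in aS b)) /=.
      rewrite !enum_rankK_in // pab set21 set22 !mul1r big1 => [|q].
        by rewrite addr0 -intrD sF.
      case/andP=> qa qb; rewrite in_set2; case: eqP => [qa'|_].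
        by case/eqP: qa; apply: enum_val_inj; rewrite enum_rankK_in.
      case: eqP => [qb'|_]; last by rewrite mul0r.
      by case/eqP: qb; apply: enum_val_inj; rewrite enum_rankK_in.
    by apply: contraNneq ab => /(congr1 enum_val); rewrite !enum_rankK_in // => ->.
  move=> i iS; have /colP/(_ (enum_rank_in iS i)) := row_full_inj full Mc.
  by rewrite !mxE enum_rankK_in // => /eqP; rewrite intr_eq0 => /eqP.
Qed.

End Extreme.

(** * Fractional pairs cannot coexist with a core partition *)

(** The matrix u = 2O + F - 2G has zero row sums, so the sum of all (s i + s j) u i j is 0. Where s
    i + s j is positive, [G] has an edge and u is at most 0; where it is negative, u is at least 0.
    Hence every term vanishes, and u i j = 0 means that [F] is absent and [O] agrees with [G]. *)
Lemma half_forced (T : finType) (G : sgraph T) (F O : rel T) (s : T -> int) :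
  half_integral (degree G) F O ->
  (forall i j, i != j -> 0 < s i + s j -> G i j) ->
  (forall i j, i != j -> s i + s j < 0 -> ~~ G i j) ->
  forall i j, s i + s j != 0 -> (F i j = false) * (O i j = G i j).
Proof.
move=> H sG sNG.
pose u i j : int := (O i j)%:R *+ 2 + (F i j)%:R - (G i j)%:R *+ 2.
have u_sym i j : u i j = u j i.
  by rewrite /u (half_symO H) (half_symF H) edge_sym.
have sum_nat (r : rel T) i : \sum_j (r i j)%:R = #|[set j | r i j]|%:R :> int.
  rewrite -sum1_card natr_sum [RHS]big_mkcond /=.
  by apply: eq_bigr => j _; rewrite inE; case: (r i j).
have u_sum i : \sum_j u i j = 0.
  rewrite /u sumrB big_split /= !sumrMnl !sum_nat (half_deg H i : #|_| = _).
  have [iS|iS] := boolP (i \in touched F).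
    by rewrite (half_reg H iS) natrD /=; ring.
  rewrite addn0; have -> : #|[set j : T | F i j]| = 0%N; last by ring.
  apply: eq_card0 => j; rewrite inE; apply: contraNF iS => Fij.
  by rewrite inE; apply/existsP; exists j.
have total : \sum_i \sum_j - ((s i + s j) * u i j) = 0.
  have -> : \sum_i \sum_j - ((s i + s j) * u i j) =
      - (\sum_i s i * \sum_j u i j + \sum_i \sum_j s j * u i j).
    rewrite -big_split -sumrN; apply: eq_bigr => i _ /=.
    rewrite mulr_sumr -big_split -sumrN; apply: eq_bigr => j _ /=.
    by rewrite mulrDl.
  rewrite [X in _ + X]exchange_big /= !big1 ?addr0 ?oppr0 // => i _.
    by under eq_bigr do rewrite u_sym; rewrite -mulr_sumr u_sum mulr0.
  by rewrite u_sum mulr0.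
have sign i j : 0 <= - ((s i + s j) * u i j).
  have [->|ij] := eqVneq i j.
    by rewrite /u (half_irrO H) (half_irrF H) edge_irr mulr0 oppr0.
  rewrite oppr_ge0; have [pos|neg|->] := ltgtP (s i + s j) 0; last by rewrite mul0r.
    rewrite nmulr_rle0 // /u (negbTE (sNG i j ij pos)).
    by case: (O i j) (F i j) => [] [].
  rewrite pmulr_rle0 // /u (sG i j ij neg).
  by have := @half_disj _ _ _ _ H i j; case: (O i j) (F i j) => [] [] //= /(_ isT).
move=> i j sij.
have : (s i + s j) * u i j = 0.
  apply/eqP; rewrite -oppr_eq0; apply/eqP.
  move/eqP: total; rewrite psumr_eq0 => [/allP/(_ i)|k _]; last by apply: sumr_ge0.
  rewrite mem_index_enum => /(_ isT) /eqP/eqP.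
  by rewrite psumr_eq0 // => /allP/(_ j); rewrite mem_index_enum => /(_ isT)/eqP.
move/eqP; rewrite mulf_eq0 (negbTE sij) /u /=.
by have := @half_disj _ _ _ _ H i j;
  case: (O i j) (F i j) (G i j) => [] [] [] //= /(_ isT).
Qed.

Definition degree_in (T : finType) (r : rel T) (A : {set T}) (i : T) : nat :=
  #|[set j in A | r i j]|.

(** The local form of [half_integral], with degrees counted inside [A], where all of [F] lives;
    unlike degrees in the whole graph it refers to nothing outside [V3]. *)
Record half_core (T : finType) (G : rel T) (A : {set T}) (F O : rel T) : Prop :=
  HalfCore {
    core_symF : symmetric F;
    core_symO : symmetric O;
    core_irrF : irreflexive F;
    core_irrO : irreflexive O;
    core_disj : forall i j, F i j -> O i j = false;
    core_supp : touched F \subset A;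
    core_reg : forall i, i \in touched F -> #|[set j | F i j]| = 2%N;
    core_deg : {in A, forall i,
      degree_in G A i = (degree_in O A i + (i \in touched F))%N};
    core_even : ~~ odd #|touched F|;
    core_rank : forall s : T -> int, (forall i j, F i j -> s i + s j = 0) ->
      forall i, i \in touched F -> s i = 0
  }.

(** This is the passage from x to 1 - x: half-valued pairs stay, and pairs of value 0 and 1 change
    places. *)
Lemma half_core_compl (T : finType) (G : sgraph T) (A : {set T}) (F O : rel T) :
  half_core G A F O ->
  half_core (compl G) A F (fun i j => [&& i != j, ~~ F i j & ~~ O i j]).
Proof.
move=> H; have SA := subsetP (core_supp H); split; try by case: H.
- by move=> i j; rewrite eq_sym (core_symF H) (core_symO H).
- by move=> i; rewrite eqxx.
- by move=> i j ->; rewrite andbF.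
move=> i iA; have degA (r : rel T) :
    degree_in r A i = (\sum_(j in A) (r i j : nat))%N.
  rewrite /degree_in -sum1_card big_mkcond [RHS]big_mkcond /=.
  by apply: eq_bigr => j _; rewrite inE; case: (j \in A); case: (r i j).
have FA : degree_in F A i = (i \in touched F).*2.
  have -> : degree_in F A i = #|[set j | F i j]|.
    apply: eq_card => j; rewrite !inE; case Fij: (F i j); rewrite ?andbF //.
    rewrite andbT; apply: SA; rewrite inE; apply/existsP; exists i.
    by rewrite (core_symF H).
  have [iS|iS] := boolP (i \in touched F); first by rewrite (core_reg H iS).
  apply: eq_card0 => j; rewrite inE; apply: contraNF iS => Fij.
  by rewrite inE; apply/existsP; exists j.
have one : (\sum_(j in A) (i != j : nat) =
    degree_in (compl G) A i + degree_in G A i)%N.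
  rewrite !degA -big_split; apply: eq_bigr => j _; rewrite complE /=.
  by  case: eqP => [<-|_] /=; [rewrite edge_irr | case: (G i j)].
have two : (\sum_(j in A) (i != j : nat) =
    degree_in (fun i j => [&& i != j, ~~ F i j & ~~ O i j]) A i +
    degree_in O A i + degree_in F A i)%N.
  rewrite !degA -!big_split; apply: eq_bigr => j _ /=.
  case: eqP => [<-|_] /=; first by rewrite (core_irrF H) (core_irrO H).
  by case Fij: (F i j); [rewrite (core_disj H Fij) | case: (O i j)].
by move: one two; rewrite FA (core_deg H iA); case: (i \in touched F); lia.
Qed.

Section HalfCore.
Variables (T : finType) (G : rel T) (A : {set T}) (F O : rel T).
Hypothesis H : half_core G A F O.
Let S := touched F.

Lemma in_support i j : F i j -> (i \in S) * (j \in S).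
Proof.
move=> Fij; rewrite !inE; split; apply/existsP; first by exists j.
by exists i; rewrite (core_symF H).
Qed.

Lemma core_nbrs i : i \in S ->
  exists a b, [/\ a != b, F i a, F i b & forall j, F i j = (j == a) || (j == b)].
Proof.
move=> iS; have /eqP/cards2P[a [b [ab /setP Fi]]] := core_reg H iS.
have FE j : F i j = (j == a) || (j == b) by have := Fi j; rewrite !inE.
by exists a, b; rewrite !FE !eqxx orbT.
Qed.

Lemma core_other_nbr i a : F i a ->
  exists2 b, a != b & forall j, F i j = (j == a) || (j == b).
Proof.
move=> Fia; have [a' [b' [ab _ _ FE]]] := core_nbrs (in_support Fia).1.
move: Fia; rewrite FE => /orP[]/eqP e; [exists b' | exists a'] => //.
- by rewrite e.
- by move=> j; rewrite FE e.
- by rewrite e eq_sym.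
- by move=> j; rewrite FE e orbC.
Qed.

Lemma core_two_nbrs i a b : F i a -> F i b -> a != b ->
  forall j, F i j = (j == a) || (j == b).
Proof.
move=> Fia Fib ab j; have [b' _ FE] := core_other_nbr Fia.
by move: Fib; rewrite FE eq_sym (negbTE ab) /= => /eqP->; apply: FE.
Qed.

(** The number of touched vertices is even and at least 3. If it were 4, [F] would be a 4-cycle,
    whose 2-colouring by 1 and -1 contradicts [core_rank]. *)
Lemma core_support_ge6 a b : F a b -> (5 < #|S|)%N.
Proof.
move=> Fab; have [c bc FaE] := core_other_nbr Fab.
have Fac : F a c by rewrite FaE eqxx orbT.
have neqF i j : F i j -> i != j.
  by apply: contraTneq => ->; rewrite (core_irrF H).
have [ab ac] := (neqF _ _ Fab, neqF _ _ Fac).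
have abc_uniq : uniq [:: a; b; c] by rewrite /= !inE negb_or ab ac bc.
have abcS : [set x in [:: a; b; c]] \subset S.
  apply/subsetP => x; rewrite !inE => /or3P[]/eqP->.
  - by have := (in_support Fab).1; rewrite inE.
  - by have := (in_support Fab).2; rewrite inE.
  - by have := (in_support Fac).2; rewrite inE.
have S3 : (2 < #|S|)%N.
  apply: leq_trans (subset_leq_card abcS).
  by rewrite cardsE (card_uniqP abc_uniq).
have Sev := core_even H; rewrite -/S in Sev.
suff S4 : #|S| != 4%N by move: S3 S4 Sev; case: #|S| => [|[|[|[|[|[|k]]]]]].
apply/eqP => S4.
have /card1P[e eE] : #|S :\: [set x in [:: a; b; c]]| == 1%N.
  by rewrite cardsD (setIidPr abcS) S4 cardsE (card_uniqP abc_uniq).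
have : e \in S :\: [set x in [:: a; b; c]] by rewrite eE inE.
rewrite in_setD inE !in_cons in_nil orbF !negb_or => /andP[/and3P[ea eb ec] eS].
have SE i : i \in S -> [|| i == a, i == b, i == c | i == e].
  move=> iS; have := eE i; rewrite in_setD iS andbT inE !in_cons in_nil orbF inE.
  by move=> <-; rewrite !orbA orbN.
have notFea : F e a = false.
  by rewrite (core_symF H) FaE (negbTE eb) (negbTE ec).
have [p [q [pq Fep Feq FeE]]] := core_nbrs eS.
have nbr_e j : F e j -> (j == b) || (j == c).
  move=> Fej; case/or4P: (SE j (in_support Fej).2) => /eqP je;
    rewrite je ?eqxx ?orbT //.
    by rewrite je notFea in Fej.
  by have := neqF _ _ Fej; rewrite je eqxx.
have [Feb Fec] : F e b /\ F e c.
  move: (nbr_e p Fep) (nbr_e q Feq) => /orP[]/eqP pE /orP[]/eqP qE;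
  move: pq Fep Feq; rewrite pE qE ?eqxx //.
have [ae ba ca] : [/\ a != e, F b a & F c a].
  by rewrite eq_sym ea !(core_symF H _ a).
have FbE := core_two_nbrs ba (etrans (core_symF H b e) Feb) ae.
have FcE := core_two_nbrs ca (etrans (core_symF H c e) Fec) ae.
have {}FeE := core_two_nbrs Feb Fec bc.
pose s i : int := if (i == a) || (i == e) then 1 else
  if (i == b) || (i == c) then -1 else 0.
have sE : [/\ s a = 1, s b = -1, s c = -1 & s e = 1].
  rewrite /s !eqxx orbT (eq_sym b a) (eq_sym b e) (eq_sym c a) (eq_sym c e).
  by rewrite (negbTE ab) (negbTE ac) (negbTE eb) (negbTE ec) orbT.
case: sE => sa sb sc se.
have sF i j : F i j -> s i + s j = 0.
  move=> Fij; move: (Fij); case/or4P: (SE i (in_support Fij).1) => /eqP->.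
  - by rewrite FaE => /orP[]/eqP->; rewrite sa ?sb ?sc.
  - by rewrite FbE => /orP[]/eqP->; rewrite sb ?sa ?se.
  - by rewrite FcE => /orP[]/eqP->; rewrite sc ?sa ?se.
  - by rewrite FeE => /orP[]/eqP->; rewrite se ?sb ?sc.
by have := core_rank H sF (in_support Fab).1; rewrite sa.
Qed.

(** Every vertex other than the centre [a] has degree 1 in [A], so a touched one has no
    [O]-neighbour there. The [O]-neighbours of [a] thus avoid the touched set and number at most
    [#|A| - 6], whereas the degree of [a] demands at least [#|A| - 4]. *)
Lemma core_star_free a c d i j : star_in G A a c d -> F i j = false.
Proof.
move=> [acd_uniq acdA A6 Gstar]; apply/negP => /core_support_ge6 S6.
have SA := subsetP (core_supp H).
have [aA cA dA] : [/\ a \in A, c \in A & d \in A].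
  by split; apply: acdA; rewrite !inE eqxx ?orbT.
move: (acd_uniq); rewrite /= !inE negb_or andbT => /andP[/andP[ac ad] cd].
have deg1 x : x \in A -> x != a -> degree_in G A x = 1%N.
  move=> xA xa; apply/eqP/cards1P.
  have star1 y : (forall z, z \in A -> star_pattern a c d x z = (z == y)) ->
      y \in A -> exists y, [set j in A | G x j] = [set y].
    move=> xy yA; exists y; apply/setP => z; rewrite !inE.
    have [zA|zA] /= := boolP (z \in A); first by rewrite Gstar // xy.
    by apply/esym; apply: contraNF zA => /eqP->.
  rewrite /star_pattern (negbTE xa) in star1.
  have [xc|xc] := eqVneq x c.
    apply: (star1 d) => // z _; rewrite xc eqxx (negbTE cd) !inE eqxx orbT /=.
    by case: eqVneq => [->|_]; rewrite ?orbF // (negbTE ad).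
  have [xd|xd] := eqVneq x d.
    apply: (star1 c) => // z _.
    rewrite xd eqxx (eq_sym d c) (negbTE cd) !inE eqxx !orbT /=.
    by case: eqVneq => [->|_]; rewrite ?orbF // (negbTE ac).
  apply: (star1 a) => // z _; rewrite !inE !(negbTE xa) (negbTE xc) (negbTE xd) /=.
  by case: eqP.
have dega : degree_in G A a = (#|A| - 3)%N.
  have -> : degree_in G A a = #|A :\: [set x in [:: a; c; d]]|.
    apply: eq_card => z; rewrite in_set in_setD in_set.
    have [zA|_] := boolP (z \in A); last by rewrite andbF.
    by rewrite andbT /= Gstar // /star_pattern eqxx.
  rewrite cardsD (setIidPr _) ?cardsE ?(card_uniqP acd_uniq) //.
  by apply/subsetP => x; rewrite inE => /acdA.
have OaS : [set x in A | O a x] \subset A :\: S.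
  apply/subsetP => x; rewrite !inE => /andP[xA Oax]; rewrite xA andbT.
  apply/negP => /existsP[y Fxy]; have xS := (in_support Fxy).1.
  have xa : x != a by apply: contraTneq Oax => ->; rewrite (core_irrO H).
  have := core_deg H xA; rewrite deg1 // xS addn1 => -[] /esym/eqP.
  rewrite cards_eq0 => /eqP/setP/(_ a); rewrite !inE aA (core_symO H) Oax.
  by [].
have := subset_leq_card OaS; rewrite cardsD (setIidPr (core_supp H)) -/S.
have := core_deg H aA; rewrite dega /degree_in.
move: A6 S6; move: #|A| #|S| #|[set x in A | O a x]| => u v w.
by case: (a \in _); lia.
Qed.

End HalfCore.

Lemma degree_U (v : 'I_6) : degree U_graph v = (if v == ord0 then 4 else 2)%N.
Proof.
have -> : degree U_graph v = count (U_adj v) (iota 0 6).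
  rewrite -(val_enum_ord 6) count_map /degree cardsE cardE enumT size_filter.
  exact: eq_count.
by case: v; do 6?[case=> //].
Qed.

(** All six vertices are touched, so [O] has degree 3 at the hub [c] and 1 elsewhere. The three
    [O]-neighbours of [c] are saturated, hence its [F]-neighbours [a] and [b] are joined by [O] and
    [F] has no triangle at [c]. Being 2-regular on six vertices, [F] is a 6-cycle, which is
    2-colourable. *)
Lemma core_U_free (T : finType) (G : rel T) (A : {set T}) (F O : rel T) :
  half_core G A F O -> embeds_onto G A U_graph -> forall i j, F i j = false.
Proof.
move=> H [f [f_inj fA fG]] i0 j0; apply/negP => Fij0.
have S6 := core_support_ge6 H Fij0.
have A6 : #|A| = 6%N by rewrite -fA card_imset // cardsT card_ord.
have SA : touched F = A.
  by apply/eqP; rewrite eqEcard (core_supp H) A6.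
have deg i : i \in A -> degree_in G A i = (if i == f ord0 then 4 else 2)%N.
  rewrite -{1}fA => /imsetP[v _ ->]; rewrite (inj_eq f_inj) -degree_U.
  rewrite /degree -(card_imset _ f_inj); apply: eq_card => x; rewrite !inE.
  rewrite -fA; apply/andP/imsetP => [[/imsetP[w _ ->] Gvw]|[w]].
    by exists w; rewrite // inE -fG.
  by rewrite inE => vw ->; rewrite imset_f ?inE // fG.
have Fsym := core_symF H; have Osym := core_symO H.
have degO i : i \in A -> degree_in O A i = (if i == f ord0 then 3 else 1)%N.
  move=> iA; have := core_deg H iA; rewrite deg // SA iA addn1.
  by case: (i == _) => -[].
set c := f ord0 in deg degO.
have cA : c \in A by rewrite -fA imset_f.
have FA i j : F i j -> (i \in A) * (j \in A).
  by rewrite -SA => /(in_support H).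
have neqF i j : F i j -> i != j.
  by apply: contraTneq => ->; rewrite (core_irrF H).
have [a [b [ab Fca Fcb FcE]]] : exists a b, [/\ a != b, F c a, F c b &
    forall j, F c j = (j == a) || (j == b)].
  by apply: (core_nbrs H); rewrite SA.
have [ca cb] := (neqF _ _ Fca, neqF _ _ Fcb).
have [aA bA] := ((FA _ _ Fca).2, (FA _ _ Fcb).2).
have cab_uniq : uniq [:: c; a; b] by rewrite /= !inE negb_or ca cb ab.
have OcE x : x \in A -> x != c -> x != a -> x != b -> O c x.
  move=> xA xc xa xb.
  have sub : [set j in A | O c j] \subset A :\: [set z in [:: c; a; b]].
    apply/subsetP => z; rewrite in_set in_setD in_set => /andP[-> Ocz].
    rewrite andbT !in_cons in_nil orbF !negb_or; apply/and3P; split.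
    - by apply: contraTneq Ocz => ->; rewrite (core_irrO H).
    - by apply: contraTneq Ocz => ->; rewrite (core_disj H Fca).
    - by apply: contraTneq Ocz => ->; rewrite (core_disj H Fcb).
  have /eqP/setP/(_ x) : [set j in A | O c j] == A :\: [set z in [:: c; a; b]].
    rewrite eqEcard sub -/(degree_in O A c) degO // eqxx cardsD (setIidPr _).
      by rewrite A6 cardsE (card_uniqP cab_uniq).
    by apply/subsetP => z; rewrite !inE => /or3P[]/eqP->.
  rewrite in_set in_setD in_set xA andbT !in_cons in_nil orbF.
  by rewrite (negbTE xc) (negbTE xa) (negbTE xb).
(* the three other vertices are saturated by their pair with [c] *)
have Osat x y : x \in A -> x != c -> x != a -> x != b -> O x y -> y \in A ->
    y = c.
  move=> xA xc xa xb Oxy yA.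
  have : degree_in O A x = 1%N by rewrite degO // (negbTE xc).
  move/eqP/cards1P => [z /setP zE].
  have := zE y; rewrite !inE yA Oxy => /esym/eqP->.
  by have := zE c; rewrite !inE cA Osym OcE // => /esym/eqP->.
have Oab : O a b.
  have : degree_in O A a = 1%N by rewrite degO // eq_sym (negbTE ca).
  move/eqP/cards1P => [z /setP zE].
  have := zE z; rewrite !inE eqxx => /andP[zA Oaz].
  have [<-//|zb] := eqVneq z b.
  have zc : z != c by apply: contraTneq Oaz => ->; rewrite Osym (core_disj H Fca).
  have za : z != a by apply: contraTneq Oaz => ->; rewrite (core_irrO H).
  have ac : a = c by apply: (Osat z) => //; rewrite Osym.
  by rewrite ac eqxx in ca.
have nFab : F a b = false.
  by apply/negP => /(core_disj H); rewrite Oab.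
have [Fac Fbc] : F a c /\ F b c by rewrite !(Fsym _ c).
have [p cp FaE] := core_other_nbr H Fac.
have [r cr FbE] := core_other_nbr H Fbc.
have Fap : F a p by rewrite FaE eqxx orbT.
have Fbr : F b r by rewrite FbE eqxx orbT.
have pb : p != b by apply: contraTneq Fap => ->; rewrite nFab.
have ra : r != a by apply: contraTneq Fbr => ->; rewrite Fsym nFab.
have [ap br] := (neqF _ _ Fap, neqF _ _ Fbr).
have [pA rA] := ((FA _ _ Fap).2, (FA _ _ Fbr).2).
have [x] : exists x, x \in A :\: [set z in [:: c; a; b; p; r]].
  apply/set0Pn; rewrite -card_gt0 cardsD A6 subn_gt0.
  apply: leq_ltn_trans (subset_leq_card (subsetIr _ _)) _.
  by rewrite cardsE (leq_ltn_trans (card_size _)).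
rewrite in_setD in_set !in_cons in_nil orbF !negb_or.
case/andP=> /and5P[xc xa xb xp xr] xA.
have xS : x \in touched F by rewrite SA.
have [y1 [y2 [y12 Fx1 Fx2 FxE]]] := core_nbrs H xS.
have nFc : F x c = false by rewrite Fsym FcE (negbTE xa) (negbTE xb).
have nFa : F x a = false by rewrite Fsym FaE (negbTE xc) (negbTE xp).
have nFb : F x b = false by rewrite Fsym FbE (negbTE xc) (negbTE xr).
have out y : F x y -> [/\ y != c, y != a, y != b & y != x].
  move=> Fxy; split; try by apply: contraTneq Fxy => ->; rewrite ?nFc ?nFa ?nFb.
  by rewrite eq_sym; apply: neqF.
(* If [p] and [r] coincide, c, a, p, b is a 4-cycle of [F], and [x] with its two neighbours would
   bring the count to seven. *)
have [pr|pr] := eqVneq p r.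
  have Fpa : F p a by rewrite Fsym.
  have Fpb : F p b by rewrite Fsym pr.
  have FpE := core_two_nbrs H Fpa Fpb ab.
  have nFp : F x p = false by rewrite Fsym FpE (negbTE xa) (negbTE xb).
  have out_p y : F x y -> y != p by apply: contraTneq => ->; rewrite nFp.
  have [y1c y1a y1b y1x] := out _ Fx1; have [y2c y2a y2b y2x] := out _ Fx2.
  have s_uniq : uniq [:: c; a; b; p; x; y1; y2].
    rewrite /= !inE !negb_or ca cb cp ab ap (eq_sym b p) pb (eq_sym c x) xc y12.
    rewrite (eq_sym a x) xa (eq_sym b x) xb (eq_sym p x) xp !(eq_sym _ y1).
    by rewrite !(eq_sym _ y2) y1c y1a y1b y1x y2c y2a y2b y2x !out_p.
  have : (#|[:: c; a; b; p; x; y1; y2]| <= #|A|)%N.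
    apply/subset_leq_card/subsetP => z; rewrite !inE.
    move=> /or4P[/eqP->|/eqP->|/eqP->|] //.
    by case/or4P=> /eqP-> //; rewrite ?(FA _ _ Fx1).2 ?(FA _ _ Fx2).2.
  by rewrite (card_uniqP s_uniq) A6.
have s_uniq : uniq [:: c; a; b; p; r; x].
  rewrite /= !inE !negb_or ca cb cp cr ab ap (eq_sym a r) ra (eq_sym b p) pb br pr.
  by rewrite !(eq_sym _ x) xc xa xb xp xr.
have AE z : z \in A -> z \in [:: c; a; b; p; r; x].
  have sub : [set z in [:: c; a; b; p; r; x]] \subset A.
    apply/subsetP => w; rewrite !inE.
    move=> /or4P[/eqP->|/eqP->|/eqP->|] //.
    by case/or3P=> /eqP->.
  have /eqP/setP/(_ z) : [set z in [:: c; a; b; p; r; x]] == A.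
    by rewrite eqEcard sub A6 cardsE (card_uniqP s_uniq).
  by rewrite in_set => ->.
have nbr_x y : F x y -> (y == p) || (y == r).
  move=> Fxy; have [/negbTE yc /negbTE ya /negbTE yb /negbTE yx] := out y Fxy.
  have := AE y (FA _ _ Fxy).2.
  by rewrite !inE yc ya yb yx orbF.
have [Fxp Fxr] : F x p /\ F x r.
  move: (nbr_x _ Fx1) (nbr_x _ Fx2) => /orP[]/eqP e1 /orP[]/eqP e2;
  move: y12 Fx1 Fx2; rewrite e1 e2 ?eqxx //.
have ax : a != x by rewrite eq_sym.
have bx : b != x by rewrite eq_sym.
have FpE := core_two_nbrs H (etrans (Fsym p a) Fap) (etrans (Fsym p x) Fxp) ax.
have FrE := core_two_nbrs H (etrans (Fsym r b) Fbr) (etrans (Fsym r x) Fxr) bx.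
have {}FxE := core_two_nbrs H Fxp Fxr pr.
(* One colour class of the hexagon c, a, p, x, r, b. *)
pose s z : int := if z \in [:: c; p; r] then 1 else -1.
have [sa sb sx] : [/\ s a = -1, s b = -1 & s x = -1].
  rewrite /s !inE !(eq_sym _ c) (negbTE ca) (negbTE cb) (eq_sym c x) (negbTE xc).
  rewrite (negbTE ap) (eq_sym a r) (negbTE ra) (eq_sym b p) (negbTE pb).
  by rewrite (negbTE br) (negbTE xp) (negbTE xr).
have [sc sp sr] : [/\ s c = 1, s p = 1 & s r = 1].
  by rewrite /s !inE !eqxx !orbT.
have sF i j : F i j -> s i + s j = 0.
  move=> Fij; have := AE i (FA _ _ Fij).1; move: Fij; rewrite !inE => + iE.
  case/or4P: iE => [/eqP->|/eqP->|/eqP->|].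
  - by rewrite FcE => /orP[]/eqP->; rewrite sc ?sa ?sb.
  - by rewrite FaE => /orP[]/eqP->; rewrite sa ?sc ?sp.
  - by rewrite FbE => /orP[]/eqP->; rewrite sb ?sc ?sr.
  case/or3P=> /eqP->.
  - by rewrite FpE => /orP[]/eqP->; rewrite sp ?sa ?sx.
  - by rewrite FrE => /orP[]/eqP->; rewrite sr ?sb ?sx.
  - by rewrite FxE => /orP[]/eqP->; rewrite sx ?sp ?sr.
by have := core_rank H sF (_ : c \in touched F); rewrite SA sc => /(_ cA).
Qed.

Lemma half_integral_core (T : finType) (G : sgraph T) (F O : rel T) :
  half_integral (degree G) F O -> has_core_partition G ->
  forall i j, F i j = false.
Proof.
move=> H [V1 [V2 [V3 [cov [d12 d13 d23] [V1i V2c] V3adj core]]]] i0 j0.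
have Gsym := edge_sym G.
have part i : [\/ i \in V1, i \in V2 | i \in V3].
  have : i \in V1 :|: V2 :|: V3 by rewrite cov inE.
  by rewrite !inE -orbA => /or3P[]; [constructor 1|constructor 2|constructor 3].
have n12 i : i \in V1 -> i \in V2 = false by move/(disjointFr d12).
have n13 i : i \in V1 -> i \in V3 = false by move/(disjointFr d13).
have n23 i : i \in V2 -> i \in V3 = false by move/(disjointFr d23).
(* For such a potential the sign of t i + t j on a pair not inside [V3] never conflicts with the
   adjacency imposed by the partition, so only pairs inside [V3] carry a condition. *)
have forced (t : T -> int) :
    (forall i, i \in V1 -> t i = -1) -> (forall i, i \in V2 -> t i = 1) ->
    (forall i, i \in V3 -> `|t i| <= 1) ->
    {in V3 &, forall i j, i != j -> 0 < t i + t j -> G i j} ->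
    {in V3 &, forall i j, i != j -> t i + t j < 0 -> ~~ G i j} ->
    forall i j, t i + t j != 0 -> (F i j = false) * (O i j = G i j).
  move=> t1 t2 t3 tG tNG; apply: (half_forced H) => i j ij.
    have := (t3 i, t3 j).
    case: (part i) (part j) => iV [] jV [ti tj];
      rewrite ?(t1 i iV) ?(t2 i iV) ?(t1 j jV) ?(t2 j jV).
    - by [].
    - by rewrite addNr ltxx.
    - by have := tj jV; rewrite ler_norml => /andP[_]; lia.
    - by rewrite subrr ltxx.
    - by move=> _; apply: V2c.
    - by move=> _; rewrite Gsym; have [+ _] := V3adj j jV; apply.
    - by have := ti iV; rewrite ler_norml => /andP[_]; lia.
    - by move=> _; have [+ _] := V3adj i iV; apply.
    - exact: tG.
  have := (t3 i, t3 j).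
  case: (part i) (part j) => iV [] jV [ti tj];
    rewrite ?(t1 i iV) ?(t2 i iV) ?(t1 j jV) ?(t2 j jV).
  - by move=> _; apply: V1i.
  - by rewrite addNr ltxx.
  - by move=> _; rewrite Gsym; have [_ +] := V3adj j jV; apply.
  - by rewrite subrr ltxx.
  - by [].
  - by have := tj jV; rewrite ler_norml => /andP[+ _]; lia.
  - by move=> _; have [_ +] := V3adj i iV; apply.
  - by have := ti iV; rewrite ler_norml => /andP[+ _]; lia.
  - exact: tNG.
pose s0 i : int := if i \in V2 then 1 else if i \in V1 then -1 else 0.
have s1 i : i \in V1 -> s0 i = -1 by move=> iV; rewrite /s0 (n12 i iV) iV.
have s2 i : i \in V2 -> s0 i = 1 by rewrite /s0 => ->.
have s3 i : i \in V3 -> s0 i = 0.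
  move=> iV; rewrite /s0; case: (boolP (i \in V2)) => [/n23|_]; first by rewrite iV.
  by case: (boolP (i \in V1)) => [/n13|_]; first by rewrite iV.
have force0 : forall i j, s0 i + s0 j != 0 -> (F i j = false) * (O i j = G i j).
  apply: forced => //.
  - by move=> i /s3->.
  - by move=> i j /s3-> /s3->.
  - by move=> i j /s3-> /s3->.
(* By [force0] the potential cancels along [F], so the rank property makes it 0 at touched vertices,
   which therefore lie in [V3]. *)
have SV3 : touched F \subset V3.
  apply/subsetP => i iS.
  have := half_rank H (s := s0) _ iS; case: (part i) => [/s1->|/s2->|//] h;
  exfalso; suff : forall i j, F i j -> s0 i + s0 j = 0 by move/h.
    by move=> k l; apply: contraTeq => /force0[->].
  by move=> k l; apply: contraTeq => /force0[->].
(* [O] and [G] agree on pairs leaving [V3], so the degree identity can be restricted to [V3]. *)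
have core3 : half_core G V3 F O.
  split=> //; try by case: H.
  move=> i iV; have := half_deg H i.
  have splitV (r : rel T) : #|[set j | r i j]| =
      (degree_in r V3 i + #|[set j | r i j] :\: V3|)%N.
    rewrite -(cardsID V3) setIC; congr (_ + _)%N.
    by apply: eq_card => j; rewrite !inE.
  rewrite /degree (splitV G) (splitV O).
  suff -> : [set j | O i j] :\: V3 = [set j | G i j] :\: V3.
    by rewrite addnAC => /addIn.
  apply/setP => j; rewrite !in_setD !in_set.
  have [|jV] := boolP (j \in V3); rewrite //=.
  apply: (force0 i j _).2; rewrite (s3 i iV) add0r.
  by case: (part j) => [/s1->|/s2->|] //; rewrite (negbTE jV).
have core3c := half_core_compl core3.
apply/negP => Fij; have S6 := core_support_ge6 core3 Fij.
case: core => [[B [Bind Bcl]]||/induced_embeds UG|].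
(* Extending the potential by -1 on the independent side and 1 on the clique side of [V3] makes it
   nowhere zero, against the rank property. *)
- pose B' := [set val y | y in B].
  have B'V i : i \in B' -> i \in V3 by case/imsetP => y _ ->; apply: valP.
  pose t i : int := if i \in V2 then 1 else if i \in V1 then -1 else
    if i \in B' then -1 else 1.
  have t1 i : i \in V1 -> t i = -1 by move=> iV; rewrite /t (n12 i iV) iV.
  have t2 i : i \in V2 -> t i = 1 by rewrite /t => ->.
  have t3 i : i \in V3 -> t i = if i \in B' then -1 else 1.
    move=> iV; rewrite /t; case: (boolP (i \in V2)) => [/n23|_]; first by rewrite iV.
    by case: (boolP (i \in V1)) => [/n13|_]; first by rewrite iV.
  have t_neq0 i : t i != 0 by rewrite /t; do 3![case: ifP => _ //].
  have forcet : forall i j, t i + t j != 0 -> (F i j = false) * (O i j = G i j).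
    apply: forced => //.
    + by move=> i /t3->; case: ifP.
    + move=> i j iV jV ij; rewrite (t3 i iV) (t3 j jV).
      case: (boolP (i \in B')) (boolP (j \in B')) => iB [] jB.
      + by [].
      + by rewrite addNr ltxx.
      + by rewrite subrr ltxx.
      move=> _; have h (k : T) (kV : k \in V3) : k \notin B' -> exist _ k kV \in ~: B.
        rewrite inE; apply: contra => kB.
        by apply/imsetP; exists (exist _ k kV).
      exact: (Bcl (exist _ i iV) (exist _ j jV) (h i iV iB) (h j jV jB) ij).
    + move=> i j iV jV ij; rewrite (t3 i iV) (t3 j jV).
      case: (boolP (i \in B')) (boolP (j \in B')) => iB [] jB; last first.
      + by [].
      + by rewrite subrr ltxx.
      + by rewrite addNr ltxx.
      move=> _; case/imsetP: iB => y yB ->; case/imsetP: jB => z zB ->.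
      exact: Bind.
  have : t i0 = 0.
    apply: (half_rank H (s := t)); last exact: (in_support core3 Fij).1.
    by move=> k l; apply: contraTeq => /forcet[->].
  by move/eqP; rewrite (negbTE (t_neq0 i0)).
- rewrite card_set_sig => V35.
  by have := leq_trans S6 (subset_leq_card SV3); rewrite leqNgt V35.
- by rewrite (core_U_free core3 UG) in Fij.
case=> [/induced_embeds/embeds_onto_compl UG|[m m3 /induced_embeds SG]|].
- by rewrite (core_U_free core3c UG) in Fij.
- have [a [c [d SA]]] := (star_inP G V3).2 (ex_intro2 _ _ m m3 SG).
  by rewrite (core_star_free core3 i0 j0 SA) in Fij.
case=> m m3 /induced_embeds/embeds_onto_co_K2_star SG.
have [a [c [d SA]]] := (star_inP (compl G) V3).2 (ex_intro2 _ _ m m3 SG).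
by rewrite (core_star_free core3c i0 j0 SA) in Fij.
Qed.

Local Close Scope ring_scope.

(** * The cycle of implications *)

Lemma decisive_of_core_partition (R : realType) (n : nat) (d : n.-tuple nat)
    (G : sgraph 'I_n) :
  realization d G -> has_core_partition G -> decisive R d.
Proof.
move=> Gd core x x_ext e; have [i [j [_ eij]]] := vpairP e.
have := half_integral_core (extreme_half_integral x_ext Gd) core i j.
rewrite (weightE x eij) => /negbT; rewrite negb_and !negbK.
by case/orP=> /eqP; [left|right].
Qed.

Lemma calB_free_of_blossom_free (n : nat) (d : n.-tuple nat) :
  (forall G : sgraph 'I_n, realization d G -> ~ has_blossom33 G) ->
  forall G : sgraph 'I_n, realization d G -> calB_free G.
Proof.
move=> noblossom G Gd A H HB GH; have [G' G'deg] := blossom_of_calB HB GH.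
by apply: noblossom => i; rewrite G'deg Gd.
Qed.

Theorem theorem5 (R : realType) (n : nat) (d : n.-tuple nat) (hd : graphic d) :
  [<-> decisive R d;
       forall G : sgraph 'I_n, realization d G -> ~ has_blossom33 G;
       forall G : sgraph 'I_n, realization d G -> calB_free G;
       exists2 G : sgraph 'I_n, realization d G & calB_free G;
       exists2 G : sgraph 'I_n, realization d G & has_core_partition G;
       forall G : sgraph 'I_n, realization d G -> has_core_partition G].
Proof.
have dec_noblossom : decisive R d ->
    forall G : sgraph 'I_n, realization d G -> ~ has_blossom33 G.
  by move=> dec G Gd Gbl; apply: (blossom_not_decisive Gd Gbl dec).
have [G0 G0d] := hd; tfae.
- exact: dec_noblossom.
- exact: calB_free_of_blossom_free.
- by move=> free; exists G0 => //; apply: free.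
- by case=> G Gd /core_of_calB_free; exists G.
(* Decisiveness depends on [d] alone, so it carries information from the realization [G] to the
   arbitrary realization [H]. *)
- case=> G Gd core H Hd; apply: core_of_calB_free.
  apply: calB_free_of_blossom_free Hd; apply: dec_noblossom.
  exact: decisive_of_core_partition Gd core.
- by move=> core; apply: (decisive_of_core_partition G0d); apply: core.
Qed.
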